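(* For all $s,t\in\mathbb{N}_0=\{0,1,2,\dots\}$, $$\nu_{st}\left(\tfrac14,\tfrac14\right)=\frac1\pi\left\{\ln4+2\sum_{k=1}^{s+t}\frac1k-B_{st}\right\},$$ where $$B_{st}=\sum_{k=1}^\infty\frac{4^k\left(s+\tfrac12\right)_k\left(t+\tfrac12\right)_k}{k\,(s+t+1)_{2k}}\;{}_3F_2\left[\begin{array}{c}\tfrac12(s+t),\ \tfrac12(s+t+1),\ -k\\ s+\tfrac12,\ t+\tfrac12\end{array};1\right].$$
   Context: For $s,t\in\mathbb{N}_0$ and real $a,b>0$ with $a+b\le\tfrac12$, the lag $(s,t)$ variogram is $$\nu_{st}(a,b):=\frac{1}{\pi^2}\int_0^\pi\int_0^\pi\frac{1-\cos(sx)\cos(ty)}{1-2a\cos x-2b\cos y}\,\mathrm{d}x\,\mathrm{d}y .$$ When $a+b=\tfrac12$ the denominator vanishes only at $(x,y)=(0,0)$, and the integral is understood as a Lebesgue integral. The Pochhammer symbol is $(w)_\ell:=w(w+1)\cdots(w+\ell-1)$, with $(w)_0=1$. The generalized hypergeometric function is $${}_3F_2\left[\begin{array}{c}\alpha_1,\alpha_2,\alpha_3\\ \beta_1,\beta_2\end{array};x\right]=\sum_{j=0}^\infty\frac{(\alpha_1)_j(\alpha_2)_j(\alpha_3)_j}{(\beta_1)_j(\beta_2)_j}\frac{x^j}{j!};$$ with the upper parameter $-k$ ($k$ a positive integer) the series terminates, i.e. it is the finite sum over $0\le j\le k$. An empty sum is $0$. *)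

(* Defs.v *)
From HB Require Import structures.
From mathcomp Require Import all_boot all_order all_algebra.
From mathcomp Require Import all_classical all_reals all_analysis.

Set Implicit Arguments.
Unset Strict Implicit.
Unset Printing Implicit Defensive.

Import Order.TTheory GRing.Theory Num.Theory.
Import numFieldNormedType.Exports.

Local Open Scope classical_set_scope.
Local Open Scope ring_scope.

(* The integral is taken in [\bar R], so that an equation [variogram s t a b =
   r%:E] with [r : R] includes the integrability of the integrand.  When
   [a + b = 1/2] the integrand at the origin is [0 / 0 = 0]; that point is
   Lebesgue-negligible. *)
Definition variogram (R : realType) (s t : nat) (a b : R) : \bar R :=
  ((pi ^+ 2)^-1%:E *
   \int[(@lebesgue_measure R) \x (@lebesgue_measure R)]_(z in
       `[0%R, pi]%classic `*` `[0%R, pi]%classic)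
     ((1 - cos (s%:R * z.1) * cos (t%:R * z.2)) /
      (1 - 2 * a * cos z.1 - 2 * b * cos z.2))%R%:E)%E.

Definition pochhammer (R : realType) (w : R) (l : nat) : R :=
  \prod_(i < l) (w + i%:R).

(* [limn] is total: this is meaningful only when the series converges, for
   instance when [a3 = - k%:R], where all terms with [j > k] vanish. *)
Definition hyp3F2 (R : realType) (a1 a2 a3 b1 b2 x : R) : R :=
  limn (fun n : nat => \sum_(0 <= j < n)
     pochhammer a1 j * pochhammer a2 j * pochhammer a3 j /
     (pochhammer b1 j * pochhammer b2 j) * (x ^+ j / j`!%:R)).

Definition B_term (R : realType) (s t k : nat) : R :=
  4 ^+ k * pochhammer (s%:R + 1 / 2) k * pochhammer (t%:R + 1 / 2) k /
  (k%:R * pochhammer ((s + t + 1)%:R) (2 * k)) *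
  hyp3F2 (1 / 2 * (s + t)%:R) (1 / 2 * (s + t + 1)%:R) (- k%:R)
         (s%:R + 1 / 2) (t%:R + 1 / 2) 1.

Definition B_sum (R : realType) (s t : nat) : R :=
  limn (fun n : nat => \sum_(1 <= k < n) B_term R s t k).

(* Main.v *)
(* Both sides turn out to be harmonic functions of [(s, t)] for the simple random
   walk on [Z^2], up to a common source at the origin. By symmetry, such a function
   is determined by its values on the diagonal and at [(1, 0)].

   For the integral, expand [1 / (1 - g)], [g = (cos x + cos y) / 2], as a geometric
   series: by monotone convergence the variogram is the sum over [n] of
   [p_n(0, 0) - p_n(s, t)], where [p_n] is the law of the walk at time [n]. Its
   Laplacian telescopes, and since [p_n(s, t)] is the product of one-dimensional
   laws in [s + t] and [s - t], the diagonal increments are Gosper-summable.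

   For the series, let [w_k(s, t)] be [k] times the [k]-th term. A binomial
   transform gives three-term contiguity relations between the [w_k], and with
   them the Laplacian of [w_k / k] is a telescoping difference in [k] whose sum
   cancels the Laplacian of [2 (1 + 1/2 + ... + 1/(s + t))].

   On the diagonal and at [(1, 0)], the remaining constants come from the
   alternating series for [ln 2] and [pi / 4], through recurrences in [s] between
   nonnegative sums that tend to [0]. *)

Require Import Defs.
From HB Require Import structures.
From mathcomp Require Import all_boot all_order all_algebra.
From mathcomp Require Import all_classical all_reals all_analysis.
From mathcomp Require Import measurable_realfun ring lra zify.
Import Order.TTheory GRing.Theory Num.Theory.
Import numFieldNormedType.Exports.
Local Open Scope classical_set_scope.
Local Open Scope ring_scope.
Set Implicit Arguments.
Unset Strict Implicit.
Unset Printing Implicit Defensive.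

(** * The discrete Laplacian and induction from the diagonal *)

Section Laplacian.
Variable R : realType.
Implicit Types (s t d M : nat).

(** Centred at [(s + 1, t + 1)], so that all five indices are natural numbers without
    subtraction. *)
Definition lap (X : nat -> nat -> R) s t : R :=
  X s.+2 t.+1 + X s t.+1 + X s.+1 t.+2 + X s.+1 t - 4 * X s.+1 t.+1.

(* The Laplacian at the boundary point [(s + 1, 0)] of a function that is even
   in its second argument. *)
Definition lap0 (X : nat -> nat -> R) s : R :=
  X s.+2 0%N + X s 0%N + 2 * X s.+1 1%N - 4 * X s.+1 0%N.

(* Induction on the distance to the diagonal, then along it: the Laplacian
   expresses the value furthest from the diagonal by the other four. *)
Lemma lap_ind (P : (nat -> R) -> Prop) (X : nat -> nat -> nat -> R) :
  (forall (a : R) u v, P u -> P v -> P (fun M => a * u M + v M)) ->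
  (forall M s t, X M s t = X M t s) ->
  (forall s, P (fun M => X M s s)) -> P (fun M => X M 1%N 0%N) ->
  (forall s t, P (fun M => lap (X M) s t)) -> (forall s, P (fun M => lap0 (X M) s)) ->
  forall s t, P (fun M => X M s t).
Proof.
move=> Plin Xsym Pdiag P10 Plap Plap0.
have D d : (forall t, P (fun M => X M (d + t)%N t)) /\
           (forall t, P (fun M => X M (d.+1 + t)%N t)).
  elim: d => [|d [IH0 IH1]]; split=> //.
    elim=> [|t IHt]; first exact: P10.
    have := Plin (- 1) _ _ IHt (Plin 2^-1 _ _ (Plap t t)
      (Plin 1 _ _ (Pdiag t.+1) (Pdiag t.+1))).
    congr P; apply/funext => M.
    by rewrite /lap (Xsym M t) (Xsym M t.+1 t.+2) !add1n; field.
  elim=> [|t IHt].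
    have := Plin (- 1) _ _ (IH0 0%N) (Plin (- 2) _ _ (IH0 1%N)
      (Plin 4 _ _ (IH1 0%N) (Plap0 d))).
    by congr P; apply/funext => M; rewrite /lap0 !addn0 addn1; ring.
  have := Plin (- 1) _ _ IHt (Plin (- 1) _ _ (IH0 t.+1) (Plin (- 1) _ _ (IH0 t.+2)
      (Plin 4 _ _ (IH1 t.+1) (Plap (d.+1 + t)%N t)))).
  by congr P; apply/funext => M; rewrite /lap !(addnS, addSn); ring.
move=> s t; have [st|/ltnW ts] := leqP t s.
  by have [/(_ t)] := D (s - t)%N; rewrite subnK.
have [/(_ s)] := D (t - s)%N; rewrite subnK // => + _.
by congr P; apply/funext => M; exact: Xsym.
Qed.

End Laplacian.

(** * The weights of the series: contiguity and telescoping *)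

Section Coefficients.
Variable R : realType.
Implicit Types (k s t n : nat).

Lemma pochhammer0 (x : R) : pochhammer x 0 = 1.
Proof. by rewrite /pochhammer big_ord0. Qed.

Lemma pochhammerSr (x : R) n : pochhammer x n.+1 = pochhammer x n * (x + n%:R).
Proof. by rewrite /pochhammer big_ord_recr. Qed.

Lemma pochhammerSl (x : R) n : pochhammer x n.+1 = x * pochhammer (x + 1) n.
Proof.
rewrite /pochhammer big_ord_recl addr0; congr (_ * _); apply: eq_bigr => i _.
by rewrite lift0 -addrA -natr1 [1 + _]addrC.
Qed.

Lemma pochhammer_gt0 (x : R) n : 0 < x -> 0 < pochhammer x n.
Proof. by move=> x0; apply: prodr_gt0 => i _; rewrite ltr_wpDr. Qed.

Lemma pochhammerD (x : R) m n :
  pochhammer x (m + n) = pochhammer x m * pochhammer (x + m%:R) n.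
Proof.
elim: n => [|n IHn]; first by rewrite addn0 pochhammer0 mulr1.
by rewrite addnS !pochhammerSr IHn natrD addrA mulrA.
Qed.

Lemma pochhammer_natS m n : pochhammer m.+1%:R n = (m + n)`!%:R / m`!%:R :> R.
Proof.
elim: n => [|n IHn].
  by rewrite pochhammer0 addn0 divff // pnatr_eq0 -lt0n fact_gt0.
rewrite pochhammerSr IHn addnS factS natrM -natrD addSn mulrAC.
by congr (_ / _); exact: mulrC.
Qed.

Definition hpoch n : R := pochhammer (1 / 2) n.

Lemma hpochS n : hpoch n.+1 = hpoch n * (1 / 2 + n%:R).
Proof. exact: pochhammerSr. Qed.

Lemma hpoch_neq0 n : hpoch n != 0.
Proof. by rewrite gt_eqF // pochhammer_gt0 // divr_gt0. Qed.

Lemma fact_neq0 n : n`!%:R != 0 :> R.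
Proof. by rewrite pnatr_eq0 -lt0n fact_gt0. Qed.

(* For [s + t > 0], [kern k s t] is the integral over [-pi/2, pi/2] of
   [(s + t) (2 cos x)^(s + t - 1) cos ((s - t) x) sin^(2k) x]. *)
Fixpoint kern k s t : R :=
  if k is k'.+1 then
    kern k' s t - (s + t)%:R / (4 * (s + t).+2%:R) * kern k' s.+1 t.+1
  else (s + t)`!%:R / (hpoch s * hpoch t).

(* This is [k * B_term R s t k] (see [B_termE]). *)
Definition wgt k s t : R :=
  4 ^+ k * hpoch (s + k) * hpoch (t + k) / (s + t + 2 * k)`!%:R * kern k s t.

Lemma kernC k s t : kern k s t = kern k t s.
Proof.
elim: k s t => [|k IHk] s t /=; first by rewrite addnC [hpoch s * _]mulrC.
by rewrite IHk (IHk s.+1) addnC.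
Qed.

Lemma wgtC k s t : wgt k s t = wgt k t s.
Proof. by rewrite /wgt (kernC k s) (addnC s t) (mulrAC (4 ^+ k)). Qed.

Lemma wgt0 s t : wgt 0 s t = 1.
Proof.
rewrite /wgt /= !addn0 expr0 mul1r mulrC mulrA.
have := hpoch_neq0 s; have := hpoch_neq0 t; have := fact_neq0 (s + t) => h1 h2 h3.
by field; rewrite h1 h2 h3.
Qed.

Ltac nz := rewrite /= ?nat1r ?natr1; repeat match goal with
  | |- is_true (_ && _) => apply/andP; split
  | |- is_true (hpoch _ != 0) => exact: hpoch_neq0
  | |- is_true (_ `!%:R != 0) => exact: fact_neq0
  | |- is_true (_ != 0) =>
    by rewrite gt_eqF // ?(ltr_wpDl, ltr_wpDr, addr_ge0, mulr_ge0, ler0n, ltr0n, addr_gt0, mulr_gt0)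
  end.

(** In the integral form of [kern] this is [cos((s-t+1)x) + cos((s-t-1)x) = 2 cos x cos((s-t)x)];
    the recursion in [k] preserves it. *)
Lemma kern_pascal k s t :
  kern k s.+1 t + kern k s t.+1 =
  (s + t).+1%:R / (s + t).+2%:R * kern k s.+1 t.+1.
Proof.
elim: k s t => [|k IHk] s t /=.
  by rewrite !(addSn, addnS) !hpochS !factS !natrM; field; nz.
have IH1 := IHk s t; have := IHk s.+1 t.+1; rewrite !(addSn, addnS) => IH2.
rewrite (_ : _ + _ = (kern k s.+1 t + kern k s t.+1) -
   (s + t).+1%:R / (4 * (s + t).+3%:R) * (kern k s.+2 t.+1 + kern k s.+1 t.+2)).
  by rewrite IH1 IH2; field; nz.
by ring.
Qed.

(* Discrete counterpart of integrating by parts the derivative of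
   [cos^(s+t) x sin^(2k+1) x e^(i(s-t)x)]. *)
Lemma kern_contig k s t :
  4 * (s + t).+1%:R * kern k s t =
  (2 * s%:R + 2 * k%:R + 1) * kern k s.+1 t + (2 * t%:R + 2 * k%:R + 1) * kern k s t.+1.
Proof.
elim: k s t => [|k IHk] s t /=.
  by rewrite !(addSn, addnS) !hpochS !factS !natrM; field; nz.
have IH1 := IHk s t; have := IHk s.+1 t.+1; rewrite !(addSn, addnS) => IH2.
have P := kern_pascal k s t.
(* Each relation is solved for one value, so that only [kern k s t.+1], [kern k s.+2 t.+1] and
   [kern k s.+1 t.+2] remain. *)
have {}IH1 : kern k s t = ((2 * s%:R + 2 * k%:R + 1) * kern k s.+1 t +
   (2 * t%:R + 2 * k%:R + 1) * kern k s t.+1) / (4 * (s + t).+1%:R).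
  by rewrite -IH1; field; nz.
have {}P : kern k s.+1 t = (s + t).+1%:R / (s + t).+2%:R * kern k s.+1 t.+1 - kern k s t.+1.
  by rewrite -P; ring.
have {}IH2 : kern k s.+1 t.+1 = ((2 * s.+1%:R + 2 * k%:R + 1) * kern k s.+2 t.+1 +
   (2 * t.+1%:R + 2 * k%:R + 1) * kern k s.+1 t.+2) / (4 * (s + t).+3%:R).
  by rewrite -IH2; field; nz.
rewrite IH1 P IH2; field; nz.
Qed.

Lemma wgtSk k s t : wgt k.+1 s t =
  4 * (s%:R + k%:R + 1 / 2) * (t%:R + k%:R + 1 / 2) /
    ((s%:R + t%:R + 2 * k%:R + 1) * (s%:R + t%:R + 2 * k%:R + 2)) * wgt k s t -
  (s + t)%:R / (s + t).+2%:R * wgt k s.+1 t.+1.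
Proof.
rewrite /wgt (mulnS 2 k) /= !(addSn, addnS) !add0n !hpochS exprS !factS !natrM.
by field; nz.
Qed.

Lemma wgt_pascal k s t :
  (s%:R + k%:R + 1 / 2) * wgt k s t.+1 + (t%:R + k%:R + 1 / 2) * wgt k s.+1 t =
  (s + t).+1%:R * (s%:R + t%:R + 2 * k%:R + 2) / (s + t).+2%:R * wgt k s.+1 t.+1.
Proof.
rewrite /wgt !(addSn, addnS) !hpochS !factS !natrM.
have P : kern k s.+1 t = (s + t).+1%:R / (s + t).+2%:R * kern k s.+1 t.+1 - kern k s t.+1.
  by rewrite -kern_pascal; ring.
by rewrite P; field; nz.
Qed.

Lemma wgt_contig k s t :
  wgt k s.+1 t + wgt k s t.+1 = 2 * (s + t).+1%:R / (s%:R + t%:R + 2 * k%:R + 1) * wgt k s t.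
Proof.
have IH1 : kern k s t = ((2 * s%:R + 2 * k%:R + 1) * kern k s.+1 t +
   (2 * t%:R + 2 * k%:R + 1) * kern k s t.+1) / (4 * (s + t).+1%:R).
  by rewrite -kern_contig; field; nz.
rewrite /wgt IH1 !(addSn, addnS) !hpochS !factS !natrM.
by field; nz.
Qed.

(** By symmetry [wgt k s s.+1 = wgt k s.+1 s], so [wgt_contig] determines this value and then
    [wgt_pascal] the next diagonal one. *)
Lemma wgt_diagS k s : wgt k s.+1 s.+1 = s.+1%:R / (s + k).+1%:R * wgt k s s.
Proof.
have P := wgt_pascal k s s; have C := wgt_contig k s s.
have {}C : wgt k s.+1 s = (s + s).+1%:R / (s%:R + s%:R + 2 * k%:R + 1) * wgt k s s.
  apply: (@mulfI _ 2); first by rewrite pnatr_eq0.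
  transitivity (wgt k s.+1 s + wgt k s s.+1); first by rewrite (wgtC k s s.+1); ring.
  by rewrite C; ring.
have {}P : wgt k s.+1 s.+1 = (2 * s%:R + 2 * k%:R + 1) * (s + s).+2%:R /
    ((s + s).+1%:R * (s%:R + s%:R + 2 * k%:R + 2)) * wgt k s.+1 s.
  rewrite (_ : _ * wgt _ _ _ = ((s + s).+2%:R /
    ((s + s).+1%:R * (s%:R + s%:R + 2 * k%:R + 2))) * ((s%:R + k%:R + 1 / 2) * wgt k s s.+1 + (s%:R + k%:R + 1 / 2) * wgt k s.+1 s)).
    by rewrite P; field; nz.
  by rewrite (wgtC k s s.+1); field; nz.
by rewrite P C; field; nz.
Qed.

(** With [wgt0] this amounts to [wgt k s s = (1/2)_k / (s+1)_k], positive and decreasing in [k]. *)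
Lemma wgtSk_diag k s : wgt k.+1 s s = (k%:R + 1 / 2) / (s + k).+1%:R * wgt k s s.
Proof. by rewrite wgtSk wgt_diagS; field; nz. Qed.

(* Creative telescoping certificates, found by fitting rational functions of [k]:
   the Laplacian of [wgt k / k] is the difference in [k] of [cert]. *)
Definition cert k s t : R :=
  ((s%:R - t%:R) / k%:R * (wgt k s t.+1 - wgt k s.+1 t) +
   2 * (wgt k s t.+1 + wgt k s.+1 t)) / (s + t).+1%:R.

Definition cert0 k s : R :=
  (3 * s%:R + 2) / (s.+1%:R * k%:R) * (wgt k s.+1 0 - wgt k s 0) +
  2 * (3 * s%:R + 2) / s.+1%:R ^+ 2 * wgt k s.+1 0 - 2 / s.+1%:R * wgt k s 0.

Lemma wgt_contigl k s t : wgt k s.+1 t =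
  2 * (s + t).+1%:R / (s%:R + t%:R + 2 * k%:R + 1) * wgt k s t - wgt k s t.+1.
Proof. by rewrite -(wgt_contig k s t) [RHS]addrK. Qed.

Lemma wgt_contigr k s t : wgt k s t.+1 =
  2 * (s + t).+1%:R / (s%:R + t%:R + 2 * k%:R + 1) * wgt k s t - wgt k s.+1 t.
Proof. by rewrite -(wgt_contig k s t) [RHS]addrAC subrr add0r. Qed.

Lemma wgt_pascalE k s t : wgt k s.+1 t.+1 =
  (s + t).+2%:R / ((s + t).+1%:R * (s%:R + t%:R + 2 * k%:R + 2)) *
  ((s%:R + k%:R + 1 / 2) * wgt k s t.+1 + (t%:R + k%:R + 1 / 2) * wgt k s.+1 t).
Proof. by rewrite wgt_pascal; field; nz. Qed.

Lemma lap_wgt k s t : (0 < k)%N ->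
  lap (fun i j => wgt k i j / k%:R) s t = cert k.+1 s t - cert k s t.
Proof.
rewrite -(ltr0n R) => k0; rewrite /lap /cert.
have k_neq0 : k%:R != 0 :> R by rewrite gt_eqF.
(* Level [k + 1] is lowered to level [k], then every value is reduced to [wgt k s t.+1] and
   [wgt k s.+1 t]; an identity between rational coefficients remains. *)
rewrite (wgtSk k s t.+1) (wgtSk k s.+1 t).
rewrite (wgt_contigr k s.+1 t.+1).
rewrite (wgt_pascalE k s.+1 t) (wgt_contigl k s.+1 t) (wgt_pascalE k s t).
rewrite !(addSn, addnS).
by field; nz.
Qed.

Lemma lap0_wgt k s : (0 < k)%N ->
  lap0 (fun i j => wgt k i j / k%:R) s = cert0 k.+1 s - cert0 k s.
Proof.
rewrite -(ltr0n R) => k0; rewrite /lap0 /cert0.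
have k_neq0 : k%:R != 0 :> R by rewrite gt_eqF.
rewrite (wgtSk k s 0) (wgtSk k s.+1 0).
rewrite (wgt_pascalE k s.+1 0).
rewrite (wgt_contigl k s.+1 0).
rewrite (wgt_pascalE k s 0) (wgt_contigr k s 0).
rewrite !(addSn, addnS, addn0).
by field; nz.
Qed.

(** The lower end of the telescoping: it is minus the Laplacian of [2 (1 + 1/2 + ... + 1/(s + t))],
    and [cert01] is its analogue on the boundary. *)
Lemma cert1 s t : cert 1 s t = 4 / ((s + t).+2%:R * (s + t).+3%:R).
Proof.
rewrite /cert !wgtSk !wgt0 !(addSn, addnS); field; nz.
Qed.

Lemma cert01 s : cert0 1 s = - (4 * s%:R + 2) / (s.+1%:R * s.+2%:R).
Proof.
rewrite /cert0 !wgtSk !wgt0 !(addSn, addnS, addn0); field; nz.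
Qed.

(** * Identification of the weights with the hypergeometric terms *)

Lemma pochhammer_oppn k j :
  pochhammer (- k%:R : R) j = (-1) ^+ j * j`!%:R * 'C(k, j)%:R.
Proof.
elim: j => [|j IHj]; first by rewrite pochhammer0 expr0 bin0 !mulr1.
rewrite pochhammerSr IHj exprS.
have [jk|kj] := leqP j k; last first.
  by rewrite (bin_small kj) (bin_small (leqW kj)) !mulr0 mul0r.
have := mul_bin_left k j => /(congr1 (GRing.natmul (1 : R))).
rewrite natrM [RHS]natrM natrB // factS natrM => E.
transitivity (- ((-1) ^+ j) * j`!%:R * ((k%:R - j%:R) * 'C(k, j)%:R) : R); first by ring.
by rewrite -E; ring.
Qed.

(** The terminating series as a binomial transform: [(-k)_j / j!] is [(-1)^j] times a binomial
    coefficient. *)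
Definition hsum k s t : R := \sum_(j < k.+1)
  pochhammer (1 / 2 * (s + t)%:R) j * pochhammer (1 / 2 * (s + t + 1)%:R) j *
  ((-1) ^+ j * 'C(k, j)%:R) /
  (pochhammer (s%:R + 1 / 2) j * pochhammer (t%:R + 1 / 2) j).

Lemma hyp3F2_hsum k s t :
  hyp3F2 (1 / 2 * (s + t)%:R) (1 / 2 * (s + t + 1)%:R) (- k%:R)
         (s%:R + 1 / 2) (t%:R + 1 / 2) 1 = hsum k s t :> R.
Proof.
apply/lim_near_cst => //; near=> n.
have kn : (k.+1 <= n)%N by near: n; exact: nbhs_infty_ge.
rewrite /hsum -(big_mkord xpredT (fun j => pochhammer (1 / 2 * (s + t)%:R) j *
  pochhammer (1 / 2 * (s + t + 1)%:R) j * ((-1) ^+ j * 'C(k, j)%:R) /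
  (pochhammer (s%:R + 1 / 2) j * pochhammer (t%:R + 1 / 2) j) : R)).
rewrite (big_cat_nat (leq0n _) kn) /= [X in _ + X]big_nat_cond [X in _ + X]big1 ?addr0.
  apply: eq_bigr => j _; rewrite pochhammer_oppn expr1n.
  have h1 : pochhammer (s%:R + 1 / 2 : R) j != 0.
    by rewrite gt_eqF // pochhammer_gt0 // ltr_wpDl // divr_gt0.
  have h2 : pochhammer (t%:R + 1 / 2 : R) j != 0.
    by rewrite gt_eqF // pochhammer_gt0 // ltr_wpDl // divr_gt0.
  by field; rewrite h1 h2 fact_neq0.
move=> j /andP[/andP[kj _] _].
by rewrite pochhammer_oppn bin_small // !(mulr0, mul0r).
Unshelve. all: by end_near. Qed.

Definition hcoef s t j : R :=
  pochhammer (1 / 2 * (s + t)%:R) j * pochhammer (1 / 2 * (s + t + 1)%:R) j /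
  (pochhammer (s%:R + 1 / 2) j * pochhammer (t%:R + 1 / 2) j).

Lemma hcoefS s t j : hcoef s t j.+1 =
  (s + t)%:R * (s + t).+1%:R / (4 * (s%:R + 1 / 2) * (t%:R + 1 / 2)) *
  hcoef s.+1 t.+1 j.
Proof.
rewrite /hcoef !pochhammerSl.
have -> : (1 / 2 * (s + t)%:R + 1 : R) = 1 / 2 * (s.+1 + t.+1)%:R.
  by rewrite addSn addnS; field.
have -> : (1 / 2 * (s + t + 1)%:R + 1 : R) = 1 / 2 * (s.+1 + t.+1 + 1)%:R.
  by rewrite addSn addnS; field.
have -> : (s%:R + 1 / 2 + 1 : R) = s.+1%:R + 1 / 2 by field.
have -> : (t%:R + 1 / 2 + 1 : R) = t.+1%:R + 1 / 2 by field.
have h1 : pochhammer (s.+1%:R + 1 / 2 : R) j != 0.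
  by rewrite gt_eqF // pochhammer_gt0 // ltr_wpDl // divr_gt0.
have h2 : pochhammer (t.+1%:R + 1 / 2 : R) j != 0.
  by rewrite gt_eqF // pochhammer_gt0 // ltr_wpDl // divr_gt0.
move: (pochhammer _ j) (pochhammer _ j) h1 h2 (pochhammer _ j) (pochhammer _ j) => x y h1 h2 z u.
by rewrite addn1; field; rewrite h1 h2; nz.
Qed.

Lemma hsumE k s t : hsum k s t =
  \sum_(j < k.+1) hcoef s t j * ((-1) ^+ j * 'C(k, j)%:R).
Proof. by apply: eq_bigr => j _; rewrite /hcoef mulrAC. Qed.

(** Pascal's rule splits the transform, and [hcoefS] turns the shift of [j] into a shift of
    [(s, t)]; up to scaling this is the recursion that defines [kern]. *)
Lemma hsumS k s t : hsum k.+1 s t = hsum k s t -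
  (s + t)%:R * (s + t).+1%:R / (4 * (s%:R + 1 / 2) * (t%:R + 1 / 2)) *
  hsum k s.+1 t.+1.
Proof.
rewrite !hsumE.
have -> : \sum_(j < k.+1) hcoef s t j * ((-1) ^+ j * 'C(k, j)%:R) =
    hcoef s t 0 + \sum_(j < k.+1) hcoef s t j.+1 * ((-1) ^+ j.+1 * 'C(k, j.+1)%:R).
  rewrite big_ord_recl expr0 bin0 !mulr1; congr (_ + _).
  by rewrite [RHS]big_ord_recr /= (bin_small (ltnSn k)) !mulr0 addr0.
rewrite big_ord_recl expr0 bin0 !mulr1 -addrA; congr (_ + _).
rewrite mulr_sumr -sumrB; apply: eq_bigr => j _.
by rewrite lift0 hcoefS binS natrD exprS; ring.
Qed.

Lemma wgt_hsum k s t : wgt k s t =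
  4 ^+ k * pochhammer (s%:R + 1 / 2) k * pochhammer (t%:R + 1 / 2) k /
  pochhammer (s + t + 1)%:R (2 * k) * hsum k s t.
Proof.
have E : kern k s t = (s + t)`!%:R / (hpoch s * hpoch t) * hsum k s t.
  elim: k s t => [|k IHk] s t /=.
    rewrite hsumE big_ord_recl big_ord0 /hcoef !pochhammer0 expr0 bin0.
    by rewrite !(mulr1, divr1, addr0).
  rewrite hsumS !IHk !hpochS !(addSn, addnS) !factS !natrM.
  by field; nz.
rewrite /wgt E addn1 pochhammer_natS /hpoch !pochhammerD -/(hpoch s) -/(hpoch t).
by rewrite ![1 / 2 + _%:R]addrC; field; nz.
Qed.

Lemma B_termE k s t : B_term R s t k = wgt k s t / k%:R.
Proof.
by rewrite /B_term hyp3F2_hsum wgt_hsum invfM; ring.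
Qed.

End Coefficients.

(** * The law of the simple random walk *)

Section Walk.
Variable R : realType.
Implicit Types (j s t : int) (n m N : nat).

(** The law at time [n] of the walk on [Z] started at 0: a binomial coefficient over [2^n] when
    [n + j] is even and [|j| <= n], else 0. The recursion spares these case distinctions. *)
Fixpoint srw1 n j : R :=
  if n is n'.+1 then (srw1 n' (j - 1) + srw1 n' (j + 1)) / 2 else (j == 0)%:R.

(* The simple random walk on [Z^2] decouples in the coordinates [s + t] and
   [s - t]. *)
Definition srw2 n s t : R := srw1 n (s + t) * srw1 n (s - t).

Lemma srw1S n j : srw1 n.+1 j = (srw1 n (j - 1) + srw1 n (j + 1)) / 2.
Proof. by []. Qed.

Lemma srw1N n j : srw1 n (- j) = srw1 n j.
Proof.
elim: n j => [|n IHn] j /=; first by rewrite oppr_eq0.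
have -> : - j - 1 = - (j + 1) by lia.
have -> : - j + 1 = - (j - 1) by lia.
by rewrite !IHn addrC.
Qed.

Lemma srw1_ge0 n j : 0 <= srw1 n j.
Proof.
elim: n j => [|n IHn] j /=; first exact: ler0n.
by rewrite divr_ge0 // addr_ge0.
Qed.

Lemma srw1_le1 n j : srw1 n j <= 1.
Proof.
elim: n j => [|n IHn] j /=; first by case: eqP.
by have := IHn (j - 1); have := IHn (j + 1); lra.
Qed.

(** The range includes [j = -1], where both sides agree by symmetry; from [j = 0] on, the induction
    uses the claim at [j - 1] and [j + 1]. *)
Lemma srw1_unimodal n j : -1 <= j -> srw1 n (j + 2) <= srw1 n j.
Proof.
elim: n j => [|n IHn] j j1 /=.
  by have [/eqP|_] := eqVneq (j + 2) 0; [lia|exact: ler0n].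
have -> : j + 2 - 1 = j + 1 by lia.
have -> : j + 2 + 1 = j + 1 + 2 by lia.
rewrite ler_pM2r // addrC lerD2r.
have [->|j0] := eqVneq j (-1); first by rewrite (_ : -1 + 1 + 2 = - (-1 - 1)) // srw1N.
apply: (@le_trans _ _ (srw1 n (j + 1))); first by apply: IHn; lia.
have -> : j + 1 = j - 1 + 2 by lia.
by apply: IHn; lia.
Qed.

Lemma srw1_parity n i : srw1 n (n%:Z + 1 + 2 * i) = 0.
Proof.
elim: n i => [|n IHn] i /=; first by have [/eqP|//] := eqVneq; lia.
have -> : n.+1%:Z + 1 + 2 * i - 1 = n%:Z + 1 + 2 * i by lia.
have -> : n.+1%:Z + 1 + 2 * i + 1 = n%:Z + 1 + 2 * (i + 1) by lia.
by rewrite !IHn addr0 mul0r.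
Qed.

Lemma srw1_even_odd m i : srw1 (2 * m) (1 + 2 * i) = 0.
Proof.
by rewrite -(srw1_parity (2 * m) (i - m%:Z)); congr srw1; lia.
Qed.

Lemma srw1_odd_even m i : srw1 (2 * m).+1 (2 * i) = 0.
Proof.
by rewrite -(srw1_parity (2 * m).+1 (i - m%:Z - 1)); congr srw1; lia.
Qed.

(** Exchangeability of the steps: given that the walk is at [j] at time [n + 1], its last step is
    upward with probability [(n + 1 + j) / (2 (n + 1))]. *)
Lemma srw1_stepl n j :
  (n.+1%:R + j%:~R) * srw1 n.+1 j = n.+1%:R * srw1 n (j - 1).
Proof.
elim: n j => [|n IHn] j.
  rewrite srw1S /= subr_eq0 addr_eq0.
  have [->|_] := eqVneq j 1; first by rewrite (_ : (1 == -1 :> int) = false) // mulr1z /=; lra.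
  have [->|_] := eqVneq j (-1); first by rewrite mulrN1z /=; lra.
  by rewrite /=; lra.
have E1 := IHn (j - 1); have E2 := IHn (j + 1).
rewrite addrK in E2.
have F : srw1 n.+1 (j - 1) = (srw1 n (j - 1 - 1) + srw1 n j) / 2 by rewrite srw1S subrK.
rewrite intrB mulr1z in E1; rewrite intrD mulr1z in E2; rewrite srw1S.
move: F E1 E2; move: (srw1 _ _) (srw1 _ _) (srw1 _ _) (srw1 _ _).
move=> a b c d F E1 E2; rewrite -!(nat1r n.+1) -!(nat1r n) in E1 E2 *.
by nra.
Qed.

Lemma srw1_stepr n j :
  (n.+1%:R - j%:~R) * srw1 n.+1 j = n.+1%:R * srw1 n (j + 1).
Proof.
have := srw1_stepl n (- j); rewrite srw1N mulrNz.
have -> : - j - 1 = - (j + 1) by lia.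
by rewrite srw1N.
Qed.

Lemma srw1_ratio n j :
  (n%:R + j%:~R + 2) * srw1 n (j + 2) = (n%:R - j%:~R) * srw1 n j.
Proof.
have l := srw1_stepl n (j + 1); have r := srw1_stepr n (j + 1).
rewrite addrK in l; rewrite -addrA (_ : 1 + 1 = 2) // in r.
rewrite intrD mulr1z -!(nat1r n) in l r.
have : n.+1%:R != 0 :> R by rewrite pnatr_eq0.
rewrite -(nat1r n) => n0; apply: (mulfI n0).
rewrite mulrCA -r [RHS]mulrCA -l; ring.
Qed.

Lemma srw1SS n j :
  (n%:R + 2 + j%:~R) * (n%:R + 2 - j%:~R) * srw1 n.+2 j =
  (n%:R + 1) * (n%:R + 2) * srw1 n j.
Proof.
have l := srw1_stepl n.+1 j; have r := srw1_stepr n (j - 1).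
rewrite subrK intrB mulr1z in r.
transitivity ((n%:R + 2 - j%:~R) * ((n.+2%:R + j%:~R) * srw1 n.+2 j)).
  by ring.
rewrite l.
transitivity ((n%:R + 2) * ((n.+1%:R - (j%:~R - 1)) * srw1 n.+1 (j - 1))).
  by ring.
by rewrite r; ring.
Qed.

Definition bret m : R := srw1 (2 * m) 0.

Lemma bret0 : bret 0 = 1.
Proof. by []. Qed.

Lemma bretS m : bret m.+1 = (m%:R + 1 / 2) / m.+1%:R * bret m.
Proof.
have := srw1SS (2 * m) 0; rewrite /bret mulnS addSn add1n addr0 subr0 => E.
have m0 : (m.+1%:R : R) != 0 by rewrite pnatr_eq0.
apply: (@mulfI _ (((2 * m)%:R + 2) * ((2 * m)%:R + 2))).
  by rewrite natrM; apply: lt0r_neq0; rewrite mulr_gt0 // ltr_wpDl.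
by rewrite E natrM; field; rewrite nat1r.
Qed.

Lemma bret_ge0 m : 0 <= bret m.
Proof. exact: srw1_ge0. Qed.

(** The left side is nonincreasing in [m] and equals 1 at [m = 0]. With [bret_sqr_nd] this is the
    Wallis bracketing of [bret m ^+ 2]. *)
Lemma bret_sqr_le m : (2 * m%:R + 1) * bret m ^+ 2 <= 1.
Proof.
elim: m => [|m IHm]; first by rewrite bret0; lra.
apply: le_trans IHm; rewrite bretS exprMn mulrA ler_wpM2r ?sqr_ge0 //.
have m0 : (m.+1%:R : R) != 0 by rewrite pnatr_eq0.
rewrite expr_div_n mulrA ler_pdivrMr ?exprn_gt0 ?ltr0n //.
rewrite -(nat1r m); have := ler0n R m; nra.
Qed.

Lemma bret_sqr_nd m : m%:R * bret m ^+ 2 <= m.+1%:R * bret m.+1 ^+ 2.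
Proof.
rewrite bretS exprMn [leRHS]mulrA ler_wpM2r ?sqr_ge0 // expr_div_n mulrA.
have m0 : (0 : R) < m.+1%:R by rewrite ltr0n.
rewrite ler_pdivlMr ?exprn_gt0 //.
rewrite -(nat1r m); have := ler0n R m; nra.
Qed.

Lemma srw1_even_le m (i : nat) : srw1 (2 * m) i <= bret m.
Proof.
elim/ltn_ind: i => -[|[|i]] IHi //.
  by have := srw1_even_odd m 0; rewrite mulr0 addr0 => ->; exact: bret_ge0.
apply: le_trans (IHi i _); last by [].
by rewrite (_ : i.+2%:Z = i%:Z + 2); [apply: srw1_unimodal; lia | lia].
Qed.

Lemma srw2_0 s t : srw2 0 s t = ((s == 0) && (t == 0))%:R.
Proof.
rewrite /srw2 /= -natrM mulnb; congr (_%:R).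
by apply/f_equal; apply/idP/idP; lia.
Qed.

Lemma srw2S n s t : srw2 n.+1 s t =
  (srw2 n (s + 1) t + srw2 n (s - 1) t + srw2 n s (t + 1) + srw2 n s (t - 1)) / 4.
Proof.
rewrite /srw2 !srw1S.
have -> : s + 1 + t = s + t + 1 by lia.
have -> : s + 1 - t = s - t + 1 by lia.
have -> : s - 1 + t = s + t - 1 by lia.
have -> : s - 1 - t = s - t - 1 by lia.
have -> : s + (t + 1) = s + t + 1 by lia.
have -> : s - (t + 1) = s - t - 1 by lia.
have -> : s + (t - 1) = s + t - 1 by lia.
have -> : s - (t - 1) = s - t + 1 by lia.
by field.
Qed.

Lemma srw2C n s t : srw2 n s t = srw2 n t s.
Proof. by rewrite /srw2 addrC -[in LHS](opprB t) srw1N. Qed.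

Lemma srw2N n s t : srw2 n s (- t) = srw2 n s t.
Proof. by rewrite /srw2 opprK mulrC. Qed.

Lemma srw2_ge0 n s t : 0 <= srw2 n s t.
Proof. by rewrite mulr_ge0 // srw1_ge0. Qed.

(** * The truncated potential kernel and its Laplacian *)

Definition green N s t : R := \sum_(0 <= n < N) (srw2 n 0 0 - srw2 n s t).

(** Averaging over the four neighbours advances time by one ([srw2S]), so the sum over [n]
    telescopes; the return terms [srw2 n 0 0] cancel. *)
Lemma green_lap N s t :
  green N (s + 1) t + green N (s - 1) t + green N s (t + 1) + green N s (t - 1)
    - 4 * green N s t = 4 * (srw2 0 s t - srw2 N s t).
Proof.
elim: N => [|N IHN]; first by rewrite /green !big_geq // subrr; ring.
have -> : srw2 0 s t - srw2 N.+1 s t = (srw2 0 s t - srw2 N s t) + (srw2 N s t - srw2 N.+1 s t).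
  by rewrite addrA subrK.
by rewrite mulrDr -IHN srw2S /green !big_nat_recr //=; field.
Qed.

Definition greenN M (s t : nat) : R := green (2 * M) s t.

Lemma greenN_sym M (s t : nat) : greenN M s t = greenN M t s.
Proof. by rewrite /greenN /green; apply: eq_bigr => n _; rewrite (srw2C n s). Qed.

Lemma lap_greenN M (s t : nat) : lap (greenN M) s t = - 4 * srw2 (2 * M) s.+1 t.+1.
Proof.
have := green_lap (2 * M) s.+1%:Z t.+1%:Z; rewrite srw2_0 /= sub0r mulrN -mulNr => <-.
by rewrite /lap /greenN; congr (green _ _ _ + green _ _ _ + green _ _ _ + green _ _ _ - _); lia.
Qed.

Lemma lap0_greenN M (s : nat) : lap0 (greenN M) s = - 4 * srw2 (2 * M) s.+1 0.
Proof.
have := green_lap (2 * M) s.+1%:Z 0; rewrite srw2_0 /= (sub0r (srw2 _ _ _)) mulrN -mulNr => <-.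
have -> : green (2 * M) s.+1 (0 - 1) = green (2 * M) s.+1 1.
  by rewrite /green; apply: eq_bigr => n _; rewrite sub0r srw2N.
rewrite /lap0 /greenN mulr_natl mulr2n !addrA.
by congr (green _ _ _ + green _ _ _ + green _ _ _ + green _ _ _ - _); lia.
Qed.

Lemma greenN00 M : greenN M 0 0 = 0.
Proof. by rewrite /greenN /green big1 // => n _; rewrite subrr. Qed.

(** The Laplacian at the origin, where the four neighbours share one value by symmetry. *)
Lemma greenN10 M : greenN M 1 0 = 1 - srw2 (2 * M) 0 0.
Proof.
have := green_lap (2 * M) 0 0; rewrite srw2_0 /= sub0r !add0r.
have -> : green (2 * M) 0 0 = greenN M 0 0 by [].
have -> : green (2 * M) 0 (- 1) = greenN M 1 0.
  by rewrite greenN_sym /greenN /green; apply: eq_bigr => n _; rewrite srw2N.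
have -> : green (2 * M) 0 1 = greenN M 1 0 by rewrite greenN_sym.
have -> : green (2 * M) (- 1) 0 = greenN M 1 0.
  by rewrite greenN_sym /greenN /green; apply: eq_bigr => n _; rewrite srw2C srw2N.
rewrite -/(greenN M 1 0) greenN00; lra.
Qed.

End Walk.

(** * Alternating series for [ln 2] and [pi / 4] *)

Section Series.
Variable R : realType.
Implicit Types (n m k : nat).

Lemma eq0_small (a C : R) : (forall n, `|a| <= C / (2 * n%:R + 1)) -> a = 0.
Proof.
move=> h; apply/eqP; rewrite -normr_le0; apply/ler_addgt0Pl => e e0; rewrite addr0.
have [n Cn] : exists n, C / e <= n%:R.
  exists (Num.truncn (`|C / e|)).+1; apply: le_trans (ler_norm _) _.
  by apply: ltW; rewrite truncnS_gt.
apply: le_trans (h n) _; rewrite ler_pdivrMr ?ltr_wpDl //.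
by move: Cn; rewrite ler_pdivrMr // => Cn; have := ler0n R n; nra.
Qed.

Lemma is_derive_monomial (c x : R) k :
  is_derive x 1 (fun y : R => c * y ^+ k.+1 / k.+1%:R) (c * x ^+ k).
Proof.
have -> : (fun y : R => c * y ^+ k.+1 / k.+1%:R) = (c / k.+1%:R) *: (@id R ^+ k.+1).
  by apply/funext => y; rewrite [in RHS]/GRing.scale /= exprfctE mulrAC.
apply: is_derive_eq.
by rewrite /GRing.scale /= mulr1 mulrA divfK // pnatr_eq0.
Qed.

(** Mean value theorem for [F] minus [y^(m+1) / (m+1)], whose derivative is nonpositive on
    [[0, 1]]. *)
Lemma increment_le (F f : R -> R) m :
  (forall x : R, 0 <= x <= 1 -> is_derive x 1 F (f x)) ->
  (forall x : R, 0 <= x <= 1 -> f x <= x ^+ m) -> F 1 - F 0 <= m.+1%:R^-1.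
Proof.
move=> dF fm; pose G := F - (fun y : R => 1 * y ^+ m.+1 / m.+1%:R).
have dG (x : R) : 0 <= x <= 1 -> is_derive x 1 G (f x - 1 * x ^+ m).
  by move=> x01; apply: is_deriveB; [exact: dF|exact: is_derive_monomial].
have [||c c01] := @MVT R G (fun x => f x - 1 * x ^+ m) 0 1 ltr01.
- by move=> x; rewrite in_itv /= => /andP[x0 x1]; apply: dG; rewrite !ltW.
- by apply: derivable_within_continuous => x; rewrite in_itv /= => /dG[].
rewrite /G !fctE expr1n expr0n /= !mul1r mul0r !subr0 mulr1 => E.
have : f c <= c ^+ m by apply: fm; move: c01; rewrite in_itv /= => /andP[? ?]; rewrite !ltW.
by rewrite -subr_le0 -E addrAC subr_le0.
Qed.

Lemma increment_norm (F f : R -> R) m :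
  (forall x : R, 0 <= x <= 1 -> is_derive x 1 F (f x)) ->
  (forall x : R, 0 <= x <= 1 -> `|f x| <= x ^+ m) -> `|F 1 - F 0| <= m.+1%:R^-1.
Proof.
move=> dF fm; rewrite ler_norml; apply/andP; split; last first.
  by apply: increment_le dF _ => x x01; apply: le_trans (ler_norm _) (fm _ x01).
rewrite lerNl opprB addrC -[F 0]opprK.
apply: (@increment_le (- F) (- f)) => [x x01|x x01].
  exact: is_deriveN (dF _ x01).
by apply: le_trans (fm _ x01); rewrite -normrN ler_norm.
Qed.

Definition leibniz n : R := \sum_(i < n) (-1) ^+ i / (2 * i%:R + 1).

Lemma leibniz_pi n : `|pi / 4 - leibniz n| <= (2 * n%:R + 1)^-1.
Proof.
(* The remainder of the arctangent series; its derivative is the remainder of a geometric series, at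
   most [x^(2n)] in absolute value. *)
pose F n0 := atan - (fun x : R => \sum_(i < n0) (-1) ^+ i * x ^+ (2 * i).+1 / (2 * i).+1%:R).
have dF (x : R) : 0 <= x <= 1 ->
    is_derive x 1 (F n) ((-1) ^+ n * x ^+ (2 * n) / (1 + x ^+ 2)).
  move=> x01; elim: n => [|n IHn].
    have -> : F 0%N = atan by apply/funext => y; rewrite /F !fctE big_ord0 subr0.
    by apply: is_derive_eq; rewrite muln0 !expr0 mulr1 mul1r.
  have -> : F n.+1 = F n - (fun y : R => (-1) ^+ n * y ^+ (2 * n).+1 / (2 * n).+1%:R).
    by apply/funext => y; rewrite /F !fctE big_ord_recr /= opprD addrA.
  have := is_deriveB IHn (is_derive_monomial ((-1) ^+ n) x (2 * n)).
  move=> h; apply: is_derive_eq.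
  have x2 : 1 + x ^+ 2 != 0 by rewrite gt_eqF // ltr_pwDl // sqr_ge0.
  by rewrite mulnS exprD !exprS; field; rewrite -?expr2 x2.
have -> : pi / 4 - leibniz n = F n 1 - F n 0.
  rewrite /F !fctE atan0 atan1 [X in _ - (0 - X)]big1; last first.
    by move=> i _; rewrite exprS mul0r mulr0 mul0r.
  rewrite !subr0; congr (_ - _); apply: eq_bigr => i _.
  by rewrite expr1n mulr1 -(natr1 (2 * i)) natrM.
rewrite -(natrM _ 2) natr1; apply: increment_norm dF _ => x x01.
have x2 : 0 < 1 + x ^+ 2 by rewrite ltr_pwDl // sqr_ge0.
have xn : 0 <= x ^+ (2 * n) by rewrite exprn_ge0 //; case/andP: x01.
rewrite !normrM normrX normrN1 expr1n mul1r (ger0_norm xn) normfV (gtr0_norm x2).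
by rewrite ler_pdivrMr // ler_peMr // lerDl sqr_ge0.
Qed.

(** Unrolled, the recursion gives [y 0 = c * leibniz n + (-1)^n y n]; nonnegativity forces
    [y n <= c / (2 n + 1)], so the error tends to 0. *)
Lemma alternating_pi (y : nat -> R) c :
  (forall n, 0 <= y n) -> (forall n, y n + y n.+1 = c / (2 * n%:R + 1)) ->
  y 0%N = c * (pi / 4).
Proof.
move=> y0 yS.
have n0 n : 0 < 2 * n%:R + 1 :> R by rewrite ltr_wpDl.
have E n : y 0%N = c * leibniz n + (-1) ^+ n * y n.
  elim: n => [|n IHn]; first by rewrite /leibniz big_ord0 mulr0 add0r mul1r.
  rewrite IHn /leibniz big_ord_recr /= mulrDr -addrA; congr (_ + _).
  have -> : y n = c / (2 * n%:R + 1) - y n.+1 by rewrite -yS addrK.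
  by rewrite exprS; field; rewrite gt_eqF.
have yle n : y n <= c / (2 * n%:R + 1) by rewrite -yS lerDl.
have c0 : 0 <= c.
  by have := yS 0%N; rewrite mulr0 add0r divr1 => <-; rewrite addr_ge0.
apply/eqP; rewrite -subr_eq0; apply/eqP; apply: (@eq0_small _ (2 * c)) => n.
rewrite (E n) (_ : _ - _ = - (c * (pi / 4 - leibniz n)) + (-1) ^+ n * y n); last by ring.
apply: le_trans (ler_normD _ _) _.
rewrite normrN !normrM normrX normrN1 expr1n mul1r (ger0_norm c0) (ger0_norm (y0 n)).
have := ler_wpM2l c0 (leibniz_pi n); have := yle n.
have -> : 2 * c / (2 * n%:R + 1) = c * (2 * n%:R + 1)^-1 + c / (2 * n%:R + 1) :> R by ring.
move=> h1 h2; exact: lerD.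
Qed.

Lemma mercator_ln2 n :
  `|ln 2 - \sum_(i < n) ((2 * i%:R + 1)^-1 - (2 * i%:R + 2)^-1)| <= (2 * n%:R + 1)^-1 :> R.
Proof.
(* The remainder of the series of [ln (1 + x)], with terms taken in pairs as they arise on the
   diagonal of [Bpart]. *)
pose F n0 := (fun x : R => ln (1 + x)) - (fun x : R => \sum_(i < n0)
  (1 * x ^+ (2 * i).+1 / (2 * i).+1%:R - 1 * x ^+ (2 * i).+2 / (2 * i).+2%:R)).
have dF (x : R) : 0 <= x <= 1 -> is_derive x 1 (F n) (x ^+ (2 * n) / (1 + x)).
  move=> /andP[x0 x1]; have x2 : 0 < 1 + x by rewrite ltr_pwDl.
  elim: n => [|n IHn].
    have -> : F 0%N = @ln R \o (fun y => 1 + y).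
      by apply/funext => y; rewrite /F !fctE big_ord0 subr0.
    have d1 : is_derive x 1 (fun y : R => 1 + y) 1.
      by rewrite -[X in is_derive _ _ _ X]add0r; exact: is_deriveD.
    have d2 : is_derive ((fun y : R => 1 + y) x) 1 (@ln R) (1 + x)^-1 by exact: is_derive1_ln.
    by rewrite muln0 expr0 mul1r -[X in is_derive _ _ _ X]mulr1; exact: is_derive1_comp d2 d1.
  have -> : F n.+1 = F n - ((fun y : R => 1 * y ^+ (2 * n).+1 / (2 * n).+1%:R) -
      (fun y : R => 1 * y ^+ (2 * n).+2 / (2 * n).+2%:R)).
    by apply/funext => y; rewrite /F !fctE big_ord_recr /= opprD addrA.
  have := is_deriveB IHn (is_deriveB (is_derive_monomial 1 x (2 * n)) (is_derive_monomial 1 x (2 * n).+1)).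
  move=> h; apply: is_derive_eq.
  by rewrite mulnS exprD !exprS; field; rewrite gt_eqF.
have -> : ln 2 - \sum_(i < n) ((2 * i%:R + 1)^-1 - (2 * i%:R + 2)^-1) = F n 1 - F n 0.
  rewrite /F !fctE addr0 ln1 [X in _ - (0 - X)]big1; last first.
    by move=> i _; rewrite !exprS !(mul0r, mulr0) subr0.
  rewrite !subr0; congr (_ - _); apply: eq_bigr => i _.
  by rewrite !expr1n !mul1r -(natr1 (2 * i).+1) -(natr1 (2 * i)) natrM -addrA.
rewrite -(natrM _ 2) natr1; apply: increment_norm dF _ => x x01.
have /andP[x0 x1] := x01; have x2 : 0 < 1 + x by rewrite ltr_pwDl.
have xn : 0 <= x ^+ (2 * n) by rewrite exprn_ge0.
rewrite ger0_norm ?divr_ge0 ?(ltW x2) // ler_pdivrMr // ler_peMr // lerDl //.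
Qed.

End Series.

(** * Decay of the weights *)

Section Limits.
Variable R : realType.
Implicit Types (s t k m n K M N : nat).
Local Notation wgt := (wgt R).
Local Notation bret := (bret R).

Lemma cvg_seq_eq (u v : nat -> R) (a b : R) :
  u @ \oo --> a -> (forall n, v n = u n) -> a = b -> v @ \oo --> b.
Proof. by move=> ua uv <-; have -> : v = u by exact/funext. Qed.

Lemma cvg_seqD (u v : nat -> R) (a b : R) : u @ \oo --> a -> v @ \oo --> b ->
  (fun n => u n + v n) @ \oo --> a + b.
Proof. exact: cvgD. Qed.

Lemma cvg_seqB (u v : nat -> R) (a b : R) : u @ \oo --> a -> v @ \oo --> b ->
  (fun n => u n - v n) @ \oo --> a - b.
Proof. exact: cvgB. Qed.

Lemma cvg_seqM (u v : nat -> R) (a b : R) : u @ \oo --> a -> v @ \oo --> b ->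
  (fun n => u n * v n) @ \oo --> a * b.
Proof. exact: cvgM. Qed.

Lemma cvg_seqZ (c : R) (u : nat -> R) (a : R) : u @ \oo --> a ->
  (fun n => c * u n) @ \oo --> c * a.
Proof. by move=> ua; exact: cvgM (cvg_cst c) ua. Qed.

Arguments cvg_seqZ c {u a}.

Lemma cvg_seq_cst (c : R) : (fun=> c : R) @ \oo --> c.
Proof. exact: cvg_cst. Qed.

Arguments cvg_seq_cst c : clear implicits.

Lemma cvg_seq_unique (u : nat -> R) (a b : R) :
  u @ \oo --> a -> u @ \oo --> b -> a = b.
Proof. exact: cvg_unique. Qed.

Lemma cvg0_squeeze (u v : nat -> R) :
  v @ \oo --> (0 : R) -> (forall n, 0 <= u n <= v n) -> u @ \oo --> (0 : R).
Proof.
move=> v0 uv; apply: (squeeze_cvgr _ (cvg_cst 0) v0).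
exact: nearW.
Qed.

Lemma cvg_inv_natD m : (fun n : nat => (n + m).+1%:R^-1 : R) @ \oo --> (0 : R).
Proof. by have := @cvg_harmonic R; rewrite -(cvg_shiftn m). Qed.

Lemma wgt_bret k : wgt k 0 0 = bret k.
Proof.
elim: k => [|k IHk]; first by rewrite wgt0 bret0.
by rewrite wgtSk_diag bretS IHk add0n.
Qed.

Lemma wgt_diag_ge0 k s : 0 <= wgt k s s.
Proof.
elim: k => [|k IHk]; first by rewrite wgt0.
by rewrite wgtSk_diag mulr_ge0 // divr_ge0 // addr_ge0.
Qed.

Lemma wgt_diag_le k s : wgt k s s <= bret k.
Proof.
rewrite -wgt_bret; elim: s => [//|s IHs]; apply: le_trans IHs.
rewrite wgt_diagS ler_piMl ?wgt_diag_ge0 // ler_pdivrMr ?ltr0n // mul1r ler_nat.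
by rewrite ltnS leq_addr.
Qed.

Lemma bret_cvg0 : bret @ \oo --> (0 : R).
Proof.
apply/cvgrPdist_le => e e0.
have := cvg_inv_natD 0 => /cvgrPdist_le /(_ (e ^+ 2) (exprn_gt0 2 e0)).
apply: filterS => n; rewrite !sub0r !normrN addn0 ger0_norm ?invr_ge0 ?ler0n // => hn.
rewrite ger0_norm ?bret_ge0 // -(@ler_pXn2r _ 2) ?nnegrE ?bret_ge0 ?(ltW e0) //.
apply: le_trans hn; rewrite -[leRHS]mul1r ler_pdivlMr ?ltr0n //.
apply: le_trans (bret_sqr_le R n); rewrite mulrC ler_wpM2r ?sqr_ge0 //.
by rewrite -natr1 lerD2r ler_peMl // ler1n.
Qed.

Lemma wgt_diag_cvg0 s : (fun k => wgt k s s) @ \oo --> (0 : R).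
Proof.
apply: (cvg0_squeeze bret_cvg0) => k.
by rewrite wgt_diag_ge0 wgt_diag_le.
Qed.

Lemma cvg_inv_ge (f : nat -> R) :
  (forall n, n.+1%:R <= f n) -> (fun n => (f n)^-1) @ \oo --> (0 : R).
Proof.
move=> hf; apply: (cvg0_squeeze (cvg_inv_natD 0)) => n.
have f0 : 0 < f n by apply: lt_le_trans (hf n).
by rewrite invr_ge0 (ltW f0) addn0 /= lef_pV2 ?posrE ?ltr0n // hf.
Qed.

(** Induction on the distance to the diagonal: [wgt_contig] expresses a value at distance [d + 1] by
    one at distance [d], times [O(1/k)], and one at distance [d - 1]. For [d = 0] the latter is the
    mirror image of the value sought. *)
Lemma wgt_cvg0 s t : (fun k => wgt k s t) @ \oo --> (0 : R).
Proof.
have step u v s' t' a : u @ \oo --> (0 : R) -> v @ \oo --> (0 : R) ->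
    (fun k => a * (2 * (s' + t').+1%:R / (s'%:R + t'%:R + 2 * k%:R + 1) * u k) - v k)
      @ \oo --> (0 : R).
  move=> u0 v0.
  have c0 : (fun k => (s'%:R + t'%:R + 2 * k%:R + 1)^-1) @ \oo --> (0 : R).
    apply: cvg_inv_ge => n; rewrite -natr1.
    by move: (ler0n R s') (ler0n R t') (ler0n R n); lra.
  apply: (cvg_seq_eq (cvg_seqB (cvg_seqZ a (cvg_seqM (cvg_seqZ (2 * (s' + t').+1%:R) c0) u0)) v0)) => //.
  by rewrite !mulr0 subr0.
have D d : (forall t, (fun k => wgt k (d + t)%N t) @ \oo --> (0 : R)) /\
           (forall t, (fun k => wgt k (d.+1 + t)%N t) @ \oo --> (0 : R)).
  elim: d => [|d [IH0 IH1]]; split => // {}t.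
  - exact: wgt_diag_cvg0.
  - apply: (cvg_seq_eq (step _ _ t t 2^-1 (wgt_diag_cvg0 t) (cvg_seq_cst 0))) => // k.
    by rewrite -wgt_contig (wgtC _ k t) add1n; field.
  - apply: (cvg_seq_eq (step _ _ (d.+1 + t)%N t 1 (IH1 t) (IH0 t.+1))) => // k.
    by rewrite mul1r -wgt_contig !addSn addnS addrK.
have [ts|/ltnW st] := leqP t s.
  by have [/(_ t)] := D (s - t)%N; rewrite subnK.
have [/(_ s)] := D (t - s)%N; rewrite subnK // => h _.
by apply: (cvg_seq_eq h) => // k; exact: wgtC.
Qed.

(** * Partial sums of the series: Laplacian, diagonal, and the point [(1, 0)] *)

Definition Bpart K s t : R := \sum_(1 <= k < K.+1) wgt k s t / k%:R.

Lemma Bpart0 s t : Bpart 0 s t = 0.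
Proof. by rewrite /Bpart big_geq. Qed.

Lemma BpartS K s t : Bpart K.+1 s t = Bpart K s t + wgt K.+1 s t / K.+1%:R.
Proof. by rewrite /Bpart big_nat_recr. Qed.

Lemma BpartC K s t : Bpart K s t = Bpart K t s.
Proof. by apply: eq_bigr => k _; rewrite wgtC. Qed.

Lemma lap_Bpart K s t : lap (Bpart K) s t = cert R K.+1 s t - cert R 1 s t.
Proof.
elim: K => [|K IHK]; first by rewrite subrr /lap !Bpart0; ring.
rewrite -[LHS](_ : lap (Bpart K) s t + lap (fun i j => wgt K.+1 i j / K.+1%:R) s t = _).
  by rewrite IHK lap_wgt //; ring.
by rewrite /lap !BpartS; ring.
Qed.

Lemma lap0_Bpart K s : lap0 (Bpart K) s = cert0 R K.+1 s - cert0 R 1 s.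
Proof.
elim: K => [|K IHK]; first by rewrite subrr /lap0 !Bpart0; ring.
rewrite -[LHS](_ : lap0 (Bpart K) s + lap0 (fun i j => wgt K.+1 i j / K.+1%:R) s = _).
  by rewrite IHK lap0_wgt //; ring.
by rewrite /lap0 !BpartS; ring.
Qed.

Lemma wgtS_cvg0 s t : (fun k => wgt k.+1 s t) @ \oo --> (0 : R).
Proof. by have := @wgt_cvg0 s t; rewrite -cvg_shiftS. Qed.

Lemma cert_cvg0 s t : (fun K => cert R K.+1 s t) @ \oo --> (0 : R).
Proof.
have ua := wgtS_cvg0 s t.+1; have ub := wgtS_cvg0 s.+1 t.
have u1 := cvg_seqZ (s%:R - t%:R) (cvg_seqM (cvg_inv_natD 0) (cvg_seqB ua ub)).
have u2 := cvg_seqZ (2 : R) (cvg_seqD ua ub).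
apply: (cvg_seq_eq (cvg_seqM (cvg_seqD u1 u2) (cvg_seq_cst (s + t).+1%:R^-1))) => [n|].
  by rewrite /cert addn0 mulrA.
by rewrite subrr !mulr0 addr0 mulr0 addr0 mul0r.
Qed.

Lemma cert0_cvg0 s : (fun K => cert0 R K.+1 s) @ \oo --> (0 : R).
Proof.
have ua := wgtS_cvg0 s.+1 0; have ub := wgtS_cvg0 s 0.
have u1 := cvg_seqZ ((3 * s%:R + 2) / s.+1%:R) (cvg_seqM (cvg_inv_natD 0) (cvg_seqB ua ub)).
have u2 := cvg_seqZ (2 * (3 * s%:R + 2) / s.+1%:R ^+ 2) ua.
have u3 := cvg_seqZ (2 / s.+1%:R) ub.
apply: (cvg_seq_eq (cvg_seqB (cvg_seqD u1 u2) u3)) => [n|].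
  by rewrite /cert0 addn0 invfM; ring.
by rewrite subrr !mulr0 addr0 subr0.
Qed.

Lemma lap_Bpart_cvg s t :
  (fun K => lap (Bpart K) s t) @ \oo --> - (4 / ((s + t).+2%:R * (s + t).+3%:R) : R).
Proof.
apply: (cvg_seq_eq (cvg_seqB (cert_cvg0 s t) (cvg_seq_cst (cert R 1 s t)))) => [n|].
  exact: lap_Bpart.
by rewrite cert1 sub0r.
Qed.

Lemma lap0_Bpart_cvg s :
  (fun K => lap0 (Bpart K) s) @ \oo --> ((4 * s%:R + 2) / (s.+1%:R * s.+2%:R) : R).
Proof.
apply: (cvg_seq_eq (cvg_seqB (cert0_cvg0 s) (cvg_seq_cst (cert0 R 1 s)))) => [n|].
  exact: lap0_Bpart.
by rewrite cert01 sub0r mulNr opprK.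
Qed.

Lemma Bpart_diag_nd s : nondecreasing_seq (fun K => Bpart K s s).
Proof.
by apply/nondecreasing_seqP => K; rewrite BpartS lerDl divr_ge0 // wgt_diag_ge0.
Qed.

Lemma Bpart_diag_le K s : Bpart K s s <= 2 / (2 * s%:R + 1).
Proof.
have s0 : 0 < 2 * s%:R + 1 :> R by rewrite ltr_wpDl.
(* The factor [1 - wgt K s s] makes the bound inductive: from [K] to [K + 1] the slack grows by
   [wgt K s s / (2 (K + 1) (s + K + 1))]. *)
suff : Bpart K s s <= 2 / (2 * s%:R + 1) * (1 - wgt K s s).
  move=> /le_trans; apply; rewrite ler_piMr ?divr_ge0 ?(ltW s0) //.
  by rewrite gerBl wgt_diag_ge0.
elim: K => [|K IHK]; first by rewrite Bpart0 wgt0 subrr mulr0.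
rewrite BpartS; apply: le_trans (lerD IHK (lexx _)) _.
have W := wgt_diag_ge0 K s; rewrite wgtSk_diag -subr_ge0.
have -> : 2 / (2 * s%:R + 1) * (1 - (K%:R + 1 / 2) / (s + K).+1%:R * wgt K s s) -
   (2 / (2 * s%:R + 1) * (1 - wgt K s s) +
    (K%:R + 1 / 2) / (s + K).+1%:R * wgt K s s / K.+1%:R) =
   wgt K s s / (2 * K.+1%:R * (s + K).+1%:R).
  by field; rewrite addrC nat1r ?gt_eqF.
by rewrite divr_ge0.
Qed.

Lemma Bpart_diag_cvg s : cvgn (fun K => Bpart K s s).
Proof.
apply: nondecreasing_is_cvgn (@Bpart_diag_nd s) _.
by exists (2 / (2 * s%:R + 1)) => _ [K _ <-]; exact: Bpart_diag_le.
Qed.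

(** Gosper summation: by [wgt_diagS] the difference of the [k]-th terms is
    [wgt k s s / (s + k + 1)], which is [2 / (2 s + 1)] times [wgt k s s - wgt k.+1 s s]. *)
Lemma Bpart_diagS K s : Bpart K s s - Bpart K s.+1 s.+1 =
  (1 / s.+1%:R - 2 * wgt K.+1 s s) / (2 * s%:R + 1).
Proof.
elim: K => [|K IHK].
  rewrite !Bpart0 wgtSk_diag wgt0 addn0; field; rewrite nat1r pnatr_eq0 /=.
  by rewrite gt_eqF // ltr_wpDl.
rewrite !BpartS opprD addrACA IHK (wgtSk_diag _ K.+1) wgt_diagS.
by field; rewrite ?gt_eqF //; do ?[apply/andP; split] => //; rewrite ?nat1r ?gt_eqF ?ltr_wpDl ?ltr_wpDr //.
Qed.

Lemma Bpart_diagS_cvg s : (fun K => Bpart K s s - Bpart K s.+1 s.+1) @ \oo -->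
  (1 / s.+1%:R / (2 * s%:R + 1) : R).
Proof.
have h := cvg_seqM (cvg_seqB (cvg_seq_cst (1 / s.+1%:R : R)) (cvg_seqZ 2 (wgtS_cvg0 s s))) (cvg_seq_cst (2 * s%:R + 1)^-1).
apply: (cvg_seq_eq h) => [n|]; first exact: Bpart_diagS.
by rewrite mulr0 subr0.
Qed.

Lemma ln4E : ln 4 = 2 * ln 2 :> R.
Proof. by rewrite (_ : 4 = 2 ^+ 2) ?lnXn // ?mulr_natl //; ring. Qed.

(** The diagonal limits [b s] decrease by twice the paired terms of the series for [ln 2], and
    [b s <= 2 / (2 s + 1)] tends to 0; hence [b 0 = 2 ln 2]. *)
Lemma Bpart00_cvg : (fun K => Bpart K 0 0) @ \oo --> (ln 4 : R).
Proof.
pose b s := limn (fun K => Bpart K s s).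
have bcvg s : (fun K => Bpart K s s) @ \oo --> b s by exact: Bpart_diag_cvg.
have bS s : b s = b s.+1 + 2 * ((2 * s%:R + 1)^-1 - (2 * s%:R + 2)^-1).
  have /eqP := cvg_seq_unique (cvg_seqB (bcvg s) (bcvg s.+1)) (@Bpart_diagS_cvg s).
  rewrite subr_eq addrC => /eqP ->; congr (_ + _).
  by field; rewrite nat1r; do ?[apply/andP; split]; rewrite ?gt_eqF ?ltr_wpDl ?ltr_wpDr.
have b_ge0 s : 0 <= b s.
  by apply: limr_ge; [exact: Bpart_diag_cvg|apply: nearW => K; rewrite sumr_ge0 // => k _;
    rewrite divr_ge0 // wgt_diag_ge0].
have b_le s : b s <= 2 / (2 * s%:R + 1).
  by apply: limr_le; [exact: Bpart_diag_cvg|apply: nearW => K; exact: Bpart_diag_le].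
have bE n : b 0%N = b n + 2 * \sum_(i < n) ((2 * i%:R + 1)^-1 - (2 * i%:R + 2)^-1).
  elim: n => [|n IHn]; first by rewrite big_ord0 mulr0 addr0.
  by rewrite IHn bS big_ord_recr /=; ring.
suff -> : ln 4 = b 0%N by exact: bcvg.
apply/esym/eqP; rewrite -subr_eq0 ln4E; apply/eqP; apply: (@eq0_small _ _ 4) => n.
rewrite (bE n) -addrA -mulrBr; apply: le_trans (ler_normD _ _) _.
rewrite normrM (ger0_norm (b_ge0 n)) ger0_norm // distrC.
have -> : 4 / (2 * n%:R + 1) = 2 / (2 * n%:R + 1) + 2 * (2 * n%:R + 1)^-1 :> R by ring.
by rewrite lerD // ler_wpM2l // mercator_ln2.
Qed.

(** For [s = 0] these are the partial sums of the arcsine series at 1; the other [s] serve to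
    evaluate it by a recurrence. *)
Definition Ypart s K : R := \sum_(k < K) wgt k s s / (2 * s%:R + 2 * k%:R + 1).

Lemma Ypart_ge0 s K : 0 <= Ypart s K.
Proof. by apply: sumr_ge0 => k _; rewrite divr_ge0 ?wgt_diag_ge0 // !addr_ge0 // mulr_ge0. Qed.

(** Gosper summation again. The last term tends to 0, which leaves the recurrence of
    [alternating_pi] with [c = 2]. *)
Lemma YpartD s K : Ypart s K + Ypart s.+1 K = 2 / (2 * s%:R + 1) -
  (2 * K%:R + 4 * s%:R + 2) / ((2 * s%:R + 1) * (2 * K%:R + 2 * s%:R + 1)) * wgt K s s.
Proof.
elim: K => [|K IHK].
  rewrite /Ypart !big_ord0 wgt0; field.
  by rewrite ?gt_eqF ?ltr_wpDl.
rewrite /Ypart !big_ord_recr /= addrACA IHK wgtSk_diag wgt_diagS.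
move: (ler0n R s) (ler0n R K) => s0 K0.
by field; do ?[apply/andP; split]; apply: lt0r_neq0; lra.
Qed.

Lemma Ypart0_cvg : Ypart 0 @ \oo --> (pi / 2 : R).
Proof.
have Yle s K : Ypart s K <= 2 / (2 * s%:R + 1).
  have := YpartD s K => E.
  apply: le_trans (_ : Ypart s K + Ypart s.+1 K <= _); first by rewrite lerDl Ypart_ge0.
  rewrite E gerBl mulr_ge0 ?wgt_diag_ge0 // divr_ge0 ?mulr_ge0 ?addr_ge0 ?mulr_ge0 //.
have Ycvg s : cvgn (Ypart s).
  apply: nondecreasing_is_cvgn.
    apply/nondecreasing_seqP => K; rewrite /Ypart big_ord_recr /= lerDl.
    by rewrite divr_ge0 ?wgt_diag_ge0 // !addr_ge0 // mulr_ge0.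
  by exists (2 / (2 * s%:R + 1)) => _ [K _ <-].
have -> : pi / 2 = 2 * (pi / 4) :> R by field.
rewrite -(@alternating_pi R (fun s => limn (Ypart s)) 2); first exact: Ycvg.
  by move=> s; apply: limr_ge => //; apply: nearW => K; exact: Ypart_ge0.
move=> s.
have h : (fun K => (2 * K%:R + 4 * s%:R + 2) / ((2 * s%:R + 1) * (2 * K%:R + 2 * s%:R + 1)) * wgt K s s) @ \oo --> (0 : R).
  have w4 : (fun K => 4 * wgt K s s) @ \oo --> (0 : R).
    by apply: (cvg_seq_eq (cvg_seqZ 4 (@wgt_diag_cvg0 s))); rewrite ?mulr0.
  apply: (cvg0_squeeze w4) => K.
  rewrite mulr_ge0 ?wgt_diag_ge0 //= ?divr_ge0 ?mulr_ge0 ?addr_ge0 ?mulr_ge0 //.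
  rewrite ler_wpM2r ?wgt_diag_ge0 // ler_pdivrMr ?mulr_gt0 ?ltr_wpDl ?addr_ge0 ?mulr_ge0 //.
  by have := ler0n R s; have := ler0n R K; nra.
apply: (cvg_seq_unique (cvg_seqD (Ycvg s) (Ycvg s.+1))).
apply: (cvg_seq_eq (cvg_seqB (cvg_seq_cst (2 / (2 * s%:R + 1))) h)) => [n|]; first exact: YpartD.
by rewrite subr0.
Qed.

(** Since [wgt k 1 0 = wgt k 0 0 / (2 k + 1)], the [k]-th terms differ by [2 wgt k 0 0 / (2 k + 1)];
    subtracting 1 removes the term [k = 0] of [Ypart]. *)
Lemma Bpart10 K : Bpart K 1 0 = Bpart K 0 0 - 2 * (Ypart 0 K.+1 - 1).
Proof.
have w1 k : wgt k 1 0 = (2 * k%:R + 1)^-1 * wgt k 0 0.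
  have := wgt_contig R k 0 0; rewrite (wgtC _ k 0 1) !addn0 !add0r => E.
  apply: (@mulfI _ 2) => //.
  transitivity (wgt k 1 0 + wgt k 1 0); first by ring.
  by rewrite E; ring.
elim: K => [|K IHK].
  by rewrite !Bpart0 /Ypart big_ord_recl big_ord0 /= wgt0 !mulr0 !add0r divr1; ring.
rewrite !BpartS IHK w1 /Ypart [in RHS]big_ord_recr /= !mulr0 !add0r; field.
by rewrite nat1r ?gt_eqF // ltr_wpDl.
Qed.

Lemma Bpart10_cvg : (fun K => Bpart K 1 0) @ \oo --> (ln 4 + 2 - pi : R).
Proof.
have Y1 : (fun K => Ypart 0 K.+1) @ \oo --> (pi / 2 : R).
  by have := Ypart0_cvg; rewrite -cvg_shiftS.
apply: (cvg_seq_eq (cvg_seqB Bpart00_cvg (cvg_seqZ 2 (cvg_seqB Y1 (cvg_seq_cst 1))))) => [n|].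
  exact: Bpart10.
by field.
Qed.

(** * The potential kernel near the diagonal and the value of [kappa] *)

Definition diagw s m : R := srw1 R (2 * m) (2 * s)%N.

Lemma srw2_diag m s : srw2 R (2 * m) s s = diagw s m * bret m.
Proof. by rewrite /srw2 subrr /diagw; congr (srw1 _ _ _ * _); lia. Qed.

Lemma srw2_diag_odd m (s : int) : srw2 R (2 * m).+1 s s = 0.
Proof.
by have := srw1_odd_even R m 0; rewrite /srw2 subrr mulr0 => ->; rewrite mulr0.
Qed.

Lemma diagw_ratio s m : diagw s.+1 m = (m%:R - s%:R) / (m + s).+1%:R * diagw s m.
Proof.
have := srw1_ratio R (2 * m) (2 * s)%N.
rewrite (_ : (2 * s)%N%:Z + 2 = (2 * s.+1)%N) -?/(diagw _ _) //; last by lia.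
rewrite -pmulrn !natrM => E.
move: (ler0n R s) (ler0n R m) => s0 m0.
apply: (@mulfI _ (2 * m%:R + 2 * s%:R + 2)); first by apply: lt0r_neq0; lra.
by rewrite E; field; apply: lt0r_neq0; lra.
Qed.

(** The factor [m + 1 - s] stays on the left, because it vanishes at [m + 1 = s]. *)
Lemma diagwS s m : (m.+1%:R - s%:R) * diagw s m.+1 =
  (m%:R + 1 / 2) * m.+1%:R / (m + s).+1%:R * diagw s m.
Proof.
have := srw1SS R (2 * m) (2 * s)%N; rewrite -pmulrn !natrM.
rewrite (_ : (2 * m).+2 = (2 * m.+1)%N); last by rewrite mulnS.
rewrite -/(diagw s m.+1) -/(diagw s m) => E.
move: (ler0n R s) (ler0n R m) => s0 m0.
apply: (@mulfI _ (2 * (2 * m%:R + 2 + 2 * s%:R))); first by apply: lt0r_neq0; lra.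
transitivity ((2 * m%:R + 2 + 2 * s%:R) * (2 * m%:R + 2 - 2 * s%:R) * diagw s m.+1).
  by ring.
by rewrite E; field; apply: lt0r_neq0; lra.
Qed.

Lemma greenN_step M s t : greenN R M.+1 s t = greenN R M s t +
  (srw2 R (2 * M) 0 0 - srw2 R (2 * M) s t) +
  (srw2 R (2 * M).+1 0 0 - srw2 R (2 * M).+1 s t).
Proof. by rewrite /greenN /green mulnS !big_nat_recr. Qed.

(* [sum_(m < M) (p_2m(s, s) - p_2m(s + 1, s + 1))] is Gosper-summable. *)
Lemma greenN_diagS M s : greenN R M s.+1 s.+1 - greenN R M s s =
  4 / (2 * s%:R + 1) * ((M%:R - s%:R) * (bret M * diagw s M)).
Proof.
elim: M => [|M IHM].
  rewrite /greenN /green muln0 !big_geq // subr0 /diagw muln0 /=.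
  by case: s => [|s] //=; rewrite ?muln0 /= !(subrr, mul0r, mulr0).
rewrite !greenN_step !srw2_diag_odd !srw2_diag.
rewrite [_ * (bret M.+1 * _)]mulrCA diagwS bretS diagw_ratio.
have -> : greenN R M s.+1 s.+1 = greenN R M s s + 4 / (2 * s%:R + 1) * ((M%:R - s%:R) * (bret M * diagw s M)).
  by rewrite -IHM addrC subrK.
move: (ler0n R s) (ler0n R M) => s0 M0.
by field; do ?[apply/andP; split]; apply: lt0r_neq0; lra.
Qed.

(** The Wallis constant in [bret m ^+ 2 ~ kappa / m]; its value is found only in [kappaE], from the
    walk itself. *)
Definition kappa : R := limn (fun m => m%:R * bret m ^+ 2).

Lemma kappa_cvg : (fun m => m%:R * bret m ^+ 2) @ \oo --> kappa.
Proof.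
apply: nondecreasing_is_cvgn.
  by apply/nondecreasing_seqP => m; exact: bret_sqr_nd.
exists 1 => _ [m _ <-]; apply: le_trans (bret_sqr_le R m).
rewrite ler_wpM2r ?sqr_ge0 //; move: (ler0n R m); lra.
Qed.

(** The ratio in [diagw_ratio] is [1 - (2 s + 1) / (M + s + 1)], so the limit does not depend on
    [s]. *)
Lemma diagw_cvg s : (fun M => M%:R * (bret M * diagw s M)) @ \oo --> kappa.
Proof.
elim: s => [|s IHs]; first exact: kappa_cvg.
have h := cvg_seqB IHs (cvg_seqZ (2 * s%:R + 1) (cvg_seqM (@cvg_inv_natD s) IHs)).
apply: (cvg_seq_eq h) => [M|]; last by rewrite mul0r mulr0 subr0.
rewrite diagw_ratio; move: (ler0n R s) (ler0n R M) => s0 M0.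
by field; apply: lt0r_neq0; lra.
Qed.

Lemma greenN_diagS_cvg s :
  (fun M => greenN R M s.+1 s.+1 - greenN R M s s) @ \oo --> 4 * kappa / (2 * s%:R + 1).
Proof.
have h0 : (fun M => bret M * diagw s M) @ \oo --> (0 : R).
  apply: (cvg0_squeeze bret_cvg0) => M.
  by rewrite mulr_ge0 ?srw1_ge0 //= ler_piMr ?srw1_ge0 // srw1_le1.
have h := cvg_seqZ (4 / (2 * s%:R + 1)) (cvg_seqB (@diagw_cvg s) (cvg_seqZ s%:R h0)).
apply: (cvg_seq_eq h) => [M|]; first by rewrite greenN_diagS mulrBl.
by rewrite mulr0 subr0 mulrAC.
Qed.

Lemma srw2_cvg0 s t : (fun M => srw2 R (2 * M) s t) @ \oo --> (0 : R).
Proof.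
apply: (cvg0_squeeze bret_cvg0) => M; rewrite srw2_ge0 /srw2 /=.
rewrite -PoszD; apply: le_trans (srw1_even_le R M (s + t)).
by rewrite ler_piMr ?srw1_ge0 // srw1_le1.
Qed.

(** Two time steps are compared at once. By parity only [srw2 (2 M) s s - srw2 (2 M + 1) (s + 1) s]
    remains; the second term is a product of averages, which unimodality bounds by the first. *)
Lemma greenN_offdiag_ge M s : greenN R M s s <= greenN R M s.+1 s.
Proof.
elim: M => [|M IHM]; first by rewrite /greenN /green muln0 !big_geq.
rewrite !greenN_step !srw2_diag_odd -subr_ge0.
have -> : srw2 R (2 * M) s.+1 s = 0.
  rewrite /srw2 (_ : s.+1%:Z - s%:Z = 1 + 2 * 0) ?srw1_even_odd ?mulr0 //; lia.
have -> : srw2 R (2 * M).+1 s.+1 s =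
    (diagw s M + diagw s.+1 M) / 2 * ((bret M + srw1 R (2 * M) 2) / 2).
  by rewrite /srw2 !srw1S /diagw /bret;
    congr ((srw1 _ _ _ + srw1 _ _ _) / 2 * ((srw1 _ _ _ + srw1 _ _ _) / 2)); lia.
have u1 : diagw s.+1 M <= diagw s M.
  by rewrite /diagw (_ : (2 * s.+1)%N%:Z = (2 * s)%N%:Z + 2); [apply: srw1_unimodal|]; lia.
have u2 : srw1 R (2 * M) 2 <= bret M by apply: (@srw1_unimodal R (2 * M) 0).
have v1 : 0 <= diagw s.+1 M by exact: srw1_ge0.
have v2 : 0 <= srw1 R (2 * M) 2 by exact: srw1_ge0.
rewrite (srw2_diag M s).
have : (diagw s M + diagw s.+1 M) / 2 * ((bret M + srw1 R (2 * M) 2) / 2) <= diagw s M * bret M.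
  by apply: ler_pM; lra.
by move=> hX; lra.
Qed.

(** The Laplacian at the diagonal point [(s + 1, s + 1)], whose neighbours are equal in pairs by
    symmetry. *)
Lemma greenN_offdiagS M s :
  greenN R M s.+2 s.+1 - greenN R M s.+1 s.+1 =
  (greenN R M s.+1 s.+1 - greenN R M s s) - (greenN R M s.+1 s - greenN R M s s)
  - 2 * srw2 R (2 * M) s.+1 s.+1.
Proof.
have := lap_greenN R M s s; rewrite /lap (greenN_sym _ M s s.+1) (greenN_sym _ M s.+1 s.+2) => E.
have -> : srw2 R (2 * M) s.+1 s.+1 = - 4^-1 * (- 4 * srw2 R (2 * M) s.+1 s.+1) by field.
by rewrite -E; field.
Qed.

(* The increments [greenN (s + 1) s - greenN s s] are nonnegative and add up
   pairwise to [4 kappa / (2 s + 1)]; as the first one is [1], this identifies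
   [1 / kappa] with four times the Leibniz series. *)
Lemma kappaE : kappa = pi^-1.
Proof.
pose a := fix a s : R := if s is s'.+1 then 4 * kappa / (2 * s'%:R + 1) - a s' else 1.
have acvg s : (fun M => greenN R M s.+1 s - greenN R M s s) @ \oo --> a s.
  elim: s => [|s IHs].
    apply: (cvg_seq_eq (cvg_seqB (cvg_seq_cst 1) (@srw2_cvg0 0 0))) => [M|]; last by rewrite subr0.
    by rewrite greenN10 greenN00 subr0.
  have h := cvg_seqB (cvg_seqB (@greenN_diagS_cvg s) IHs) (cvg_seqZ 2 (@srw2_cvg0 s.+1 s.+1)).
  apply: (cvg_seq_eq h) => [M|]; first exact: greenN_offdiagS.
  by rewrite mulr0 subr0.
have a0 s : 0 <= a s.
  rewrite -(cvg_lim (@norm_hausdorff _ _) (acvg s)); apply: limr_ge; first exact: cvgP (acvg s).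
  by apply: nearW => M; rewrite subr_ge0 greenN_offdiag_ge.
have E : 1 = 4 * kappa * (pi / 4).
  by apply: (@alternating_pi _ a) => // s /=; rewrite addrC subrK.
have p0 : pi != 0 :> R by rewrite gt_eqF // pi_gt0.
by apply: (mulIf p0); rewrite mulVf // [RHS]E; field.
Qed.

(** * Agreement of the potential kernel with the series *)

Lemma greenN_cvg s t :
  (fun M => pi * greenN R M s t -
    (ln 4 + 2 * \sum_(1 <= k < (s + t).+1) 1 / k%:R - Bpart M s t)) @ \oo --> (0 : R).
Proof.
pose H n : R := \sum_(1 <= k < n.+1) 1 / k%:R.
have HS n : H n.+1 = H n + 1 / n.+1%:R by rewrite /H big_nat_recr.
have H0 : H 0%N = 0 by rewrite /H big_geq.
have p0 : pi != 0 :> R by rewrite gt_eqF // pi_gt0.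
(* Only the difference of the two sides is followed, so convergence of [Bpart] off the diagonal is
   not presupposed. *)
move: s t; apply: (@lap_ind R (fun u => u @ \oo --> (0 : R))
  (fun M s t => pi * greenN R M s t - (ln 4 + 2 * H (s + t)%N - Bpart M s t))).
- move=> a u v u0 v0; apply: (cvg_seq_eq (cvg_seqD (cvg_seqZ a u0) v0)) => //.
  by rewrite mulr0 addr0.
- by move=> M s t; rewrite greenN_sym addnC BpartC.
- elim=> [|s IHs].
    apply: (cvg_seq_eq (cvg_seqB Bpart00_cvg (cvg_seq_cst (ln 4)))) => [M|]; last by rewrite subrr.
    by rewrite greenN00 addn0 H0; ring.
  (* As [pi * kappa = 1], the increments cancel: [4/(2s+1) - 2 (1/(2s+1) + 1/(2s+2)) -
     1/((s+1)(2s+1)) = 0]. *)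
  have h := cvg_seqD IHs (cvg_seqB (cvg_seqB (cvg_seqZ pi (@greenN_diagS_cvg s))
     (cvg_seq_cst (2 * (1 / (s + s).+1%:R + 1 / (s + s).+2%:R)))) (@Bpart_diagS_cvg s)).
  apply: (cvg_seq_eq h) => [M|].
    by rewrite addSn addnS !HS; ring.
  rewrite kappaE; move: (ler0n R s) => s0.
  move: (@pi R) p0 => p p0.
  by field; do ?[apply/andP; split]; first [exact: p0 | apply: lt0r_neq0; lra].
- have h := cvg_seqD (cvg_seqZ pi (cvg_seqB (cvg_seq_cst 1) (@srw2_cvg0 0 0))) (cvg_seqB Bpart10_cvg (cvg_seq_cst (ln 4 + 2))).
  apply: (cvg_seq_eq h) => [M|]; last by ring.
  by rewrite greenN10 addn0 HS H0; field.
- move=> s t.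
  (* The kernel contributes a transition probability that tends to 0; the constant is minus the
     Laplacian of [2 H (s + t)] and cancels the limit for [Bpart]. *)
  have h := cvg_seqD (cvg_seqZ (pi * - 4) (@srw2_cvg0 s.+1 t.+1)) (cvg_seqD (@lap_Bpart_cvg s t)
    (cvg_seq_cst (4 / ((s + t).+2%:R * (s + t).+3%:R)))).
  apply: (cvg_seq_eq h) => [M|]; last by rewrite mulr0 add0r addNr.
  rewrite -[pi * - 4 * _]mulrA -lap_greenN /lap !(addSn, addnS) !HS.
  by move: (ler0n R s) (ler0n R t) => s0 t0; field; do ?[apply/andP; split]; apply: lt0r_neq0; lra.
- move=> s.
  have h := cvg_seqD (cvg_seqZ (pi * - 4) (@srw2_cvg0 s.+1 0)) (cvg_seqD (@lap0_Bpart_cvg s)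
    (cvg_seq_cst (- ((4 * s%:R + 2) / (s.+1%:R * s.+2%:R))))).
  apply: (cvg_seq_eq h) => [M|]; last by rewrite mulr0 add0r subrr.
  rewrite -[pi * - 4 * _]mulrA -lap0_greenN /lap0 !(addSn, addnS, addn0) !HS.
  by move: (ler0n R s) => s0; field; do ?[apply/andP; split]; apply: lt0r_neq0; lra.
Qed.

(** Monotonicity gives convergence on the diagonal; the convergent Laplacians carry it to all
    [(s, t)]. *)
Lemma Bpart_is_cvg s t : cvgn (fun K => Bpart K s t).
Proof.
move: s t; apply: (@lap_ind R (fun u => cvgn u) Bpart).
- move=> a u v u0 v0; exact: cvgP (cvg_seqD (cvg_seqZ a u0) v0).
- exact: BpartC.
- exact: Bpart_diag_cvg.
- exact: cvgP Bpart10_cvg.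
- by move=> s t; exact: cvgP (@lap_Bpart_cvg s t).
- by move=> s; exact: cvgP (@lap0_Bpart_cvg s).
Qed.

End Limits.

(** * The integral over the square and monotone convergence *)

Section Torus.
Variable R : realType.
Implicit Types (s t : int) (n : nat).
Local Notation mu := (@lebesgue_measure R).
Local Notation I := (`[0%R, @pi R]%classic).
Local Notation D := (I `*` I).

Lemma integral_cos (s : int) :
  (\int[mu]_(x in I) (cos (s%:~R * x))%:E = (pi * (s == 0)%:R)%:E)%E.
Proof.
have [->|s0] := eqVneq s 0.
  under eq_integral do rewrite mul0r cos0.
  by rewrite integral_cst //= lebesgue_measure_itv /= lte_fin pi_gt0 mul1e EFinN sube0 mulr1.
have sR : s%:~R != 0 :> R by rewrite intr_eq0.
pose F := fun x : R => s%:~R^-1 * sin (s%:~R * x).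
have dF (x : R) : is_derive x 1 F (cos (s%:~R * x)).
  have d1 : is_derive x 1 (fun x : R => s%:~R * x) s%:~R.
    by rewrite -[X in is_derive _ _ _ X]mulr1; exact: is_deriveZ.
  have d2 : is_derive x 1 (@sin R \o (fun x : R => s%:~R * x)) (cos (s%:~R * x) * s%:~R).
    exact: is_derive1_comp.
  have := @is_deriveZ _ _ _ _ s%:~R^-1 x 1 _ d2.
  by move=> h; apply: is_derive_eq; rewrite /GRing.scale /= mulrCA mulVf // mulr1.
have cF : continuous F.
  by move=> x; apply: differentiable_continuous; apply/derivable1_diffP; case: (dF x).
rewrite (@continuous_FTC2 _ _ F) ?pi_gt0 //.
- rewrite /F mulr0 sin0 !mulr0 sube0.
  have sinpi (n : nat) : sin (n%:R * pi) = 0 :> R.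
    elim: n => [|n IHn]; first by rewrite mul0r sin0.
    by rewrite -natr1 mulrDl mul1r sinD IHn sinpi mul0r mulr0 addr0.
  case: s {s0 sR F dF cF} => n; rewrite ?NegzE ?mulrNz -pmulrn.
    by rewrite sinpi mulr0.
  by rewrite mulNr sinN sinpi oppr0 mulr0.
- apply: continuous_subspaceT => x.
  apply: continuous_comp; last exact: continuous_cos.
  exact: mulrl_continuous.
- split.
  + by move=> x _; case: (dF x).
  + by apply: cvg_at_right_filter; exact: cF.
  + by apply: cvg_at_left_filter; exact: cF.
- by move=> x _; rewrite derive1E; case: (dF x).
Qed.

Definition trig s t (z : R * R) : R := cos (s%:~R * z.1) * cos (t%:~R * z.2).

(** The characteristic function of one step of the walk on [Z^2]; at [a = b = 1/4] the denominator
    of the variogram is [1 - step z]. *)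
Definition step (z : R * R) : R := (cos z.1 + cos z.2) / 2.

Lemma measurable_cosM (s : int) : measurable_fun [set: R] (fun x : R => cos (s%:~R * x)).
Proof.
apply: continuous_measurable_fun => x.
by apply: continuous_comp; [exact: mulrl_continuous|exact: continuous_cos].
Qed.

Lemma measurable_trig s t : measurable_fun [set: R * R] (trig s t).
Proof.
apply: measurable_funM.
  exact: (measurableT_comp (measurable_cosM s) measurable_fst).
exact: (measurableT_comp (measurable_cosM t) measurable_snd).
Qed.

Lemma measurable_step : measurable_fun [set: R * R] step.
Proof.
have c1 := @continuous_measurable_fun R cos (@continuous_cos R).
apply: measurable_funM => //; apply: measurable_funD.
  exact: (measurableT_comp c1 measurable_fst).
exact: (measurableT_comp c1 measurable_snd).
Qed.

Lemma measurable_square : measurable (D : set (measurableTypeR R * measurableTypeR R)).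
Proof. exact: measurableX. Qed.

Lemma measure_square : (mu \x mu)%E D = (pi ^+ 2)%:E.
Proof.
rewrite product_measure1E // /lebesgue_measure /=.
by rewrite !lebesgue_measure_itv /= lte_fin pi_gt0 EFinN sube0.
Qed.

Lemma integrable_bounded (f : R * R -> R) (C : R) : measurable_fun [set: R * R] f ->
  (forall z, `|f z| <= C) -> (mu \x mu)%E.-integrable D (EFin \o f).
Proof.
move=> mf fC; apply: measurable_bounded_integrable.
- exact: measurable_square.
- have h : ((mu \x mu)%E D < +oo)%E by rewrite measure_square ltry.
  exact: h.
- exact: measurable_funTS.
- by exists C; split; [exact: num_real|move=> M CM z _; apply: le_trans (fC z) (ltW CM)].
Qed.

Lemma integrable_cos (s : int) : mu.-integrable I (fun x => (cos (s%:~R * x))%:E).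
Proof.
apply: (@measurable_bounded_integrable _ _ _ mu (fun x => cos (s%:~R * x)) I) => //.
- by rewrite /= lebesgue_measure_itv /= lte_fin pi_gt0 EFinN sube0 ltry.
- exact: measurable_funTS (measurable_cosM s).
- exists 1; split; first exact: num_real.
  by move=> M M1 x _; apply: le_trans (ltW M1); rewrite ler_norml cos_geN1 cos_le1.
Qed.

Lemma trig_le1 s t z : `|trig s t z| <= 1.
Proof.
have c1 (x : R) : `|cos x| <= 1 by rewrite ler_norml cos_geN1 cos_le1.
by rewrite normrM mulr_ile1.
Qed.

Lemma step_le1 z : `|step z| <= 1.
Proof.
rewrite /step ler_norml.
by move: (cos_geN1 z.1) (cos_le1 z.1) (cos_geN1 z.2) (cos_le1 z.2); lra.
Qed.

Lemma integral_trig s t : (\int[mu \x mu]_(z in D) (trig s t z)%:E =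
  (pi ^+ 2 * ((s == 0) && (t == 0))%:R)%:E)%E.
Proof.
have itr := integrable_bounded (measurable_trig s t) (trig_le1 s t).
rewrite integral_mkcond -integral12_prod_meas1; last first.
  exact: ((integrable_mkcond _ measurable_square).1 itr).
(* Fubini is used on the whole plane for the integrand extended by 0; the indicator of the square
   splits into those of its sides. *)
transitivity (\int[mu]_x (((fun x => (pi * (t == 0)%:R)%:E * (cos (s%:~R * x))%:E) \_ I) x))%E.
  apply: eq_integral => x _; rewrite patchE.
  case: ifPn => xI.
    transitivity (\int[mu]_y (((fun y => (cos (s%:~R * x))%:E * (cos (t%:~R * y))%:E) \_ I) y))%E.
      apply: eq_integral => y _; rewrite !patchE.
      by rewrite in_setX /= xI.
    rewrite -integral_mkcond integralZl //; last exact: integrable_cos.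
    by rewrite integral_cos muleC.
  by apply: integral0_eq => y _; rewrite patchE in_setX /= (negbTE xI).
rewrite -integral_mkcond integralZl //; last exact: integrable_cos.
by rewrite integral_cos -EFinM; congr (_%:E); rewrite -mulnb natrM; ring.
Qed.

(** Addition formulas for the cosine: multiplication by [step] averages over the four neighbours, as
    one step of the walk does in [srw2S]. *)
Lemma trig_step s t z : trig s t z * step z =
  4^-1 * (trig (s + 1) t z + trig (s - 1) t z + trig s (t + 1) z + trig s (t - 1) z).
Proof.
by rewrite /trig /step !intrD mulrN1z !mulrDl !mulNr !mul1r !cosD !cosN !sinN; field.
Qed.

Lemma measurable_trigX s t n : measurable_fun [set: R * R] (fun z => trig s t z * step z ^+ n).
Proof.
apply: measurable_funM; first exact: measurable_trig.
by apply: measurable_funX; exact: measurable_step.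
Qed.

Lemma integrable_trigX s t n :
  (mu \x mu)%E.-integrable D (EFin \o (fun z => trig s t z * step z ^+ n)).
Proof.
apply: (@integrable_bounded _ 1); first exact: measurable_trigX.
by move=> z; rewrite normrM normrX mulr_ile1 ?exprn_ge0 ?exprn_ile1 ?trig_le1 ?step_le1.
Qed.

(** Fourier representation of the law of the walk: both sides have the same start and the same
    recursion in [n]. *)
Lemma integral_trigX s t n :
  (\int[mu \x mu]_(z in D) (trig s t z * step z ^+ n)%:E = (pi ^+ 2 * srw2 R n s t)%:E)%E.
Proof.
elim: n s t => [|n IHn] s t.
  under eq_integral do rewrite expr0 mulr1.
  by rewrite integral_trig srw2_0.
have mD := measurable_square.
transitivity (\int[mu \x mu]_(z in D) (4^-1%:E *
    ((trig (s + 1) t z * step z ^+ n)%:E + (trig (s - 1) t z * step z ^+ n)%:E +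
     (trig s (t + 1) z * step z ^+ n)%:E + (trig s (t - 1) z * step z ^+ n)%:E)))%E.
  apply: eq_integral => z _; rewrite -!EFinD -EFinM; congr (_%:E).
  by rewrite exprS mulrA trig_step; ring.
rewrite integralZl //; last first.
  by do 3?apply: integrableD => //; exact: integrable_trigX.
rewrite !integralD //; try by do 3?apply: integrableD => //; exact: integrable_trigX.
by rewrite !IHn srw2S -!EFinD -EFinM; congr (_%:E); field.
Qed.

Definition increment s t n (z : R * R) : R :=
  trig 0 0 z * step z ^+ n - trig s t z * step z ^+ n.

Lemma incrementE s t n z : increment s t n z = (1 - trig s t z) * step z ^+ n.
Proof. by rewrite /increment {1}/trig !mul0r cos0 mulr1 mulrBl. Qed.

Lemma integrable_increment s t n : (mu \x mu)%E.-integrable D (EFin \o increment s t n).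
Proof.
have mD := measurable_square.
apply: (integrableB mD (integrable_trigX 0 0 n) (integrable_trigX s t n)).
Qed.

Lemma integral_increment s t n : (\int[mu \x mu]_(z in D) (increment s t n z)%:E =
  (pi ^+ 2 * (srw2 R n 0 0 - srw2 R n s t))%:E)%E.
Proof.
have mD := measurable_square.
rewrite /increment (integralB_EFin mD (integrable_trigX 0 0 n) (integrable_trigX s t n)).
by rewrite !integral_trigX -EFinB mulrBr.
Qed.

(* The last term makes the partial sums nondecreasing, and makes their limit
   [(1 - trig s t z) / (1 - step z)] correct also at the point where
   [step z = -1]. *)
Definition partial s t N (z : R * R) : R :=
  \sum_(0 <= n < 2 * N) increment s t n z + 2^-1 * increment s t (2 * N) z.

Lemma partialE s t N z : partial s t N z =
  (1 - trig s t z) * (\sum_(0 <= n < 2 * N) step z ^+ n + 2^-1 * step z ^+ (2 * N)).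
Proof.
rewrite /partial incrementE; under eq_bigr do rewrite incrementE.
by rewrite -mulr_sumr; ring.
Qed.

(** The two new powers and the change of the halved last term combine to a square, hence
    monotonicity even where [step z < 0]. *)
Lemma partialS s t N z : partial s t N.+1 z =
  partial s t N z + (1 - trig s t z) * (2^-1 * (step z ^+ (2 * N) * (1 + step z) ^+ 2)).
Proof. by rewrite !partialE mulnS !big_nat_recr //= !exprS; field. Qed.

Lemma partial_nd s t N z : partial s t N z <= partial s t N.+1 z.
Proof.
rewrite partialS lerDl; apply: mulr_ge0.
  by rewrite subr_ge0 (le_trans (ler_norm _)) // trig_le1.
apply: mulr_ge0; first by rewrite invr_ge0.
by apply: mulr_ge0; rewrite ?sqr_ge0 // exprM exprn_ge0 ?sqr_ge0.
Qed.

Lemma partial_ge0 s t N z : 0 <= partial s t N z.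
Proof.
elim: N => [|N IHN]; last exact: le_trans IHN (partial_nd s t N z).
rewrite partialE muln0 big_geq // expr0 add0r mulr1 mulr_ge0 ?invr_ge0 //.
by rewrite subr_ge0 (le_trans (ler_norm _)) // trig_le1.
Qed.

Lemma integrable_partial_sum s t k : (mu \x mu)%E.-integrable D
  (fun z => \sum_(0 <= n < k) (increment s t n z)%:E)%E.
Proof.
apply: integrable_sum; first exact: measurable_square.
by move=> n _; exact: integrable_increment.
Qed.

Lemma integrable_partial_end s t n : (mu \x mu)%E.-integrable D
  (fun z => 2^-1%:E * (increment s t n z)%:E)%E.
Proof.
by apply: integrableZl; [exact: measurable_square|exact: integrable_increment].
Qed.

Lemma EFin_partial s t N z : ((partial s t N z)%:E =
  \sum_(0 <= n < 2 * N) (increment s t n z)%:E + 2^-1%:E * (increment s t (2 * N) z)%:E)%E.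
Proof. by rewrite /partial EFinD sumEFin EFinM. Qed.

Lemma integral_partial s t N : (\int[mu \x mu]_(z in D) (partial s t N z)%:E =
  (pi ^+ 2 * (green R (2 * N) s t + 2^-1 * (srw2 R (2 * N) 0 0 - srw2 R (2 * N) s t)))%:E)%E.
Proof.
have mD := measurable_square.
under eq_integral do rewrite EFin_partial.
rewrite (integralD mD (integrable_partial_sum s t _) (integrable_partial_end s t _)).
rewrite (integralZl mD (integrable_increment s t _)) integral_increment.
rewrite (integral_sum mD (fun n => integrable_increment s t n)).
under eq_bigr do rewrite integral_increment.
by rewrite sumEFin -EFinM -EFinD; congr (_%:E); rewrite -mulr_sumr /green; ring.
Qed.

Lemma partial_cvg s t z : D z ->
  (fun N => partial s t N z) @ \oo --> (1 - trig s t z) / (1 - step z).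
Proof.
move=> [/=]; rewrite !in_itv /= => z1 z2.
(* In [D] the value 1 occurs only at the origin; there all partial sums are 0, and so is the claimed
   limit, as [0 / 0 = 0]. *)
have [g1|g1] := eqVneq (step z) 1.
  have c1 : cos z.1 = 1.
    by move: g1; rewrite /step; move: (cos_le1 z.1) (cos_le1 z.2); lra.
  have c2 : cos z.2 = 1.
    by move: g1; rewrite /step; move: (cos_le1 z.1) (cos_le1 z.2); lra.
  have p0 : (0 : R) \in `[0, pi] by rewrite in_itv /= lexx pi_ge0.
  have e1 : z.1 = 0 by apply: cos_inj => //; rewrite ?in_itv // c1 cos0.
  have e2 : z.2 = 0 by apply: cos_inj => //; rewrite ?in_itv // c2 cos0.
  have T1 : trig s t z = 1 by rewrite /trig e1 e2 !mulr0 cos0 mulr1.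
  have -> : (fun N => partial s t N z) = cst 0.
    by apply/funext => N; rewrite partialE T1 subrr mul0r.
  by rewrite T1 subrr mul0r; exact: cvg_cst.
have g0 : 1 - step z != 0 by rewrite subr_eq0 eq_sym.
have E N : partial s t N z = (1 - trig s t z) / (1 - step z) -
    (1 - trig s t z) * (1 + step z) / (2 * (1 - step z)) * (step z ^+ 2) ^+ N.
  rewrite partialE -exprM.
  have -> : \sum_(0 <= n < 2 * N) step z ^+ n = (1 - step z ^+ (2 * N)) / (1 - step z).
    by rewrite big_mkord -opprB subrX1 -mulNr opprB mulrAC mulfV // mul1r.
  by field.
have -> : (fun N => partial s t N z) = (fun N => (1 - trig s t z) / (1 - step z) -
    (1 - trig s t z) * (1 + step z) / (2 * (1 - step z)) * (step z ^+ 2) ^+ N).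
  exact/funext.
(* At -1 the power does not decay, but its coefficient contains [1 + step z] and vanishes. *)
have [gN1|gN1] := eqVneq (step z) (-1).
  have -> : 1 + step z = 0 by rewrite gN1 subrr.
  rewrite mulr0 mul0r; under eq_fun do rewrite mul0r subr0.
  exact: cvg_cst.
rewrite -[X in _ --> X]subr0; apply: cvgB; first exact: cvg_cst.
rewrite -[X in _ --> X](mulr0 ((1 - trig s t z) * (1 + step z) / (2 * (1 - step z)))).
apply: cvgM; first exact: cvg_cst.
apply: cvg_expr; rewrite normrX exprn_ilt1 // lt_neqAle step_le1 andbT.
by rewrite eqr_norml negb_and ler01 orbF negb_or g1.
Qed.

Lemma integral_variogram s t :
  (fun N => \int[mu \x mu]_(z in D) (partial s t N z)%:E)%E @ \oo -->
  (\int[mu \x mu]_(z in D) ((1 - trig s t z) / (1 - step z))%:E)%E.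
Proof.
have mD := measurable_square.
have -> : (\int[mu \x mu]_(z in D) ((1 - trig s t z) / (1 - step z))%:E =
    \int[mu \x mu]_(z in D) limn (fun N => (partial s t N z)%:E))%E.
  apply: eq_integral => z; rewrite inE => Dz; apply/esym/cvg_lim => //.
  by apply: cvg_EFin; [exact: nearW|exact: partial_cvg].
apply: cvg_monotone_convergence => //.
- move=> N; rewrite (funext (EFin_partial s t N)).
  apply: (@measurable_int _ _ _ (mu \x mu)%E).
  by apply: integrableD => //; [exact: integrable_partial_sum|exact: integrable_partial_end].
- by move=> N z _; rewrite lee_fin partial_ge0.
- by move=> z _; apply/nondecreasing_seqP => N; rewrite lee_fin partial_nd.
Qed.

Lemma variogram_lim (s t : nat) (l : R) :
  (fun N => greenN R N s t) @ \oo --> l ->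
  variogram s t (1 / 4 : R) (1 / 4 : R) = l%:E.
Proof.
move=> gl.
have p0 : pi ^+ 2 != 0 :> R by rewrite expf_neq0 // gt_eqF // pi_gt0.
rewrite /variogram.
rewrite (_ : (\int[_]_(z in _) _)%E = (pi ^+ 2 * l)%:E).
  by rewrite -EFinM mulrA mulVf // mul1r.
rewrite (_ : (\int[_]_(z in _) _)%E =
    \int[mu \x mu]_(z in D) ((1 - trig s t z) / (1 - step z))%:E)%E; last first.
  apply: eq_integral => z _; congr (_%:E); rewrite /trig /step -!pmulrn.
  by congr (_ / _); field.
apply: cvg_unique (@integral_variogram s t) _ => //.
have -> : (fun N => \int[mu \x mu]_(z in D) (partial s t N z)%:E)%E =
  (fun N => (pi ^+ 2 * (greenN R N s t + 2^-1 * (srw2 R (2 * N) 0 0 - srw2 R (2 * N) s t)))%:E).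
  by apply/funext => N; exact: integral_partial.
apply: cvg_EFin; first exact: nearW.
(* The integral of the halved last term tends to 0, since the probabilities at time [2 N] do. *)
have h : (fun N => pi ^+ 2 * (greenN R N s t +
    2^-1 * (srw2 R (2 * N) 0 0 - srw2 R (2 * N) s t))) @ \oo --> (pi ^+ 2 * l : R).
  apply: (cvg_seq_eq (@cvg_seqZ R (pi ^+ 2) _ _ (cvg_seqD gl (@cvg_seqZ R 2^-1 _ _
    (cvg_seqB (@srw2_cvg0 R 0 0) (@srw2_cvg0 R s t)))))) => //.
  by rewrite subrr mulr0 addr0.
exact: h.
Qed.

End Torus.

Theorem theorem3 (R : realType) (s t : nat) :
  cvgn (fun n : nat => \sum_(1 <= k < n) B_term R s t k) /\
  variogram s t (1 / 4 : R) (1 / 4 : R) =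
    (1 / pi * (ln 4 + 2 * (\sum_(1 <= k < (s + t).+1) 1 / k%:R) - B_sum R s t))%:E.
Proof.
have BE : (fun K => \sum_(1 <= k < K.+1) B_term R s t k) = (fun K => Bpart R K s t).
  by apply/funext => K; apply: eq_bigr => k _; rewrite B_termE.
have Bcvg : (fun n => \sum_(1 <= k < n) B_term R s t k) @ \oo --> limn (fun K => Bpart R K s t).
  by rewrite -cvg_shiftS /= BE; exact: Bpart_is_cvg.
split; first exact: cvgP Bcvg.
rewrite /B_sum (cvg_lim _ Bcvg) //; apply: variogram_lim.
have p0 : pi != 0 :> R by rewrite gt_eqF // pi_gt0.
(* Adding the convergent right side to the null sequence of [greenN_cvg] and dividing by [pi] gives
   the limit of [greenN]. *)
have := @cvg_seqZ R pi^-1 _ _ (cvg_seqD (@greenN_cvg R s t)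
  (cvg_seqB (@cvg_seq_cst R (ln 4 + 2 * \sum_(1 <= k < (s + t).+1) 1 / k%:R)) (@Bpart_is_cvg R s t))).
move=> h; apply: (cvg_seq_eq h) => [N|]; last by rewrite add0r div1r.
by rewrite subrK mulrA mulVf // mul1r.
Qed.
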